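(* Let $\alpha$ be an irreducible, ergodic and nonexpansive automorphism of a compact connected abelian group $X$, and let $Y$ be a topologically transitive (two-sided) sofic shift with finite alphabet. Then every continuous equivariant map $\phi:Y\to X$ sends $Y$ to a finite set.
   Context: A continuous automorphism $\alpha$ of a compact abelian group $X$ is irreducible if every closed $\alpha$-invariant subgroup of $X$ other than $X$ itself is finite. Ergodicity is with respect to Haar measure; nonexpansive means not expansive. A sofic shift is a subshift that is a continuous shift-equivariant image of a shift of finite type with finite alphabet. A map $\phi:Y\to X$ is equivariant if $\phi\circ T=\alpha\circ\phi$, where $T$ is the shift on $Y$, $(Ty)_n=y_{n+1}$. *)

(* Defs.v *)
From HB Require Import structures.
From mathcomp Require Import all_boot all_order all_algebra.
From mathcomp Require Import all_classical all_reals all_analysis.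

Set Implicit Arguments.
Unset Strict Implicit.
Unset Printing Implicit Defensive.

Import Order.TTheory GRing.Theory Num.Theory.

Local Open Scope classical_set_scope.
Local Open Scope ring_scope.

(** * Symbolic dynamics *)

Notation full_shift A := {ptws int -> discrete_topology A}.

Definition shift_iter (A : finType) (k : int) (y : full_shift A) :
    full_shift A :=
  fun n => y (n + k).

Definition subshift (A : finType) (Y : set (full_shift A)) : Prop :=
  closed Y /\ shift_iter 1 @` Y = Y.

Definition occurs (A : finType) (w : seq A) (y : full_shift A) : Prop :=
  exists n : int, [seq y (n + i%:Z) | i <- iota 0 (size w)] = w.

Definition shift_of_finite_type (A : finType) (Y : set (full_shift A)) : Prop :=
  exists F : seq (seq A), Y = [set y | forall w, w \in F -> ~ occurs w y].

(* Maps out of a subshift are represented by maps on the whole full shift, of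
   which only the restriction to the subshift matters; [{within Y, continuous
   phi}] is continuity of that restriction for the subspace topology. *)
Definition sofic_shift (A : finType) (Y : set (full_shift A)) : Prop :=
  subshift Y /\
  exists (B : finType) (Z : set (full_shift B))
         (psi : full_shift B -> full_shift A),
    [/\ shift_of_finite_type Z,
        {within Z, continuous psi},
        (forall z, Z z -> psi (shift_iter 1 z) = shift_iter 1 (psi z)) &
        psi @` Z = Y].

(* The shift is a homeomorphism, so the times range over all of [int];
   for nonempty subshifts this is the existence of a dense two-sided orbit. *)
Definition topologically_transitive (A : finType) (Y : set (full_shift A)) :
    Prop :=
  forall U V : set (full_shift A), open U -> open V ->
    Y `&` U !=set0 -> Y `&` V !=set0 ->
    exists (n : int) (y : full_shift A), [/\ Y y, U y & V (shift_iter n y)].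

(** * Automorphisms of topological abelian groups *)

(* When the group is compact Hausdorff, continuity of the inverse follows. *)
Record automorphism (X : topologicalZmodType) := Automorphism {
  aut :> {additive X -> X};
  aut_inv : X -> X;
  autK : cancel aut aut_inv;
  aut_invK : cancel aut_inv aut;
  aut_continuous : continuous aut }.

Definition aut_iter (X : topologicalZmodType) (alpha : automorphism X)
    (n : int) : X -> X :=
  match n with
  | Posz k => iter k alpha
  | Negz k => iter k.+1 (aut_inv alpha)
  end.

Definition is_subgroup (X : zmodType) (H : set X) : Prop :=
  H 0 /\ forall x y, H x -> H y -> H (x - y).

(* Invariance is [alpha H = H], not just [alpha H `<=` H]; the two lead to
   different notions of irreducibility, e.g. for multiplication by 2 on the
   dyadic solenoid and its closed subgroup of 2-adic integers. *)
Definition irreducible (X : topologicalZmodType) (alpha : automorphism X) :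
    Prop :=
  forall H : set X, closed H -> is_subgroup H -> alpha @` H = H ->
    H <> [set: X] -> finite_set H.

(* Expansiveness for the uniformity of the group [X], which is the only one
   compatible with its topology when [X] is compact Hausdorff. *)
Definition expansive (X : topologicalZmodType) (alpha : automorphism X) :
    Prop :=
  exists2 U : set X, nbhs 0 U &
    forall x y, (forall n, U (aut_iter alpha n x - aut_iter alpha n y)) ->
      x = y.

(** * Haar measure and ergodicity *)

(* Measurable types are pointed; [pointed_group X] is [X] with base point 0. *)
Definition pointed_group (X : topologicalZmodType) : Type := X.

HB.instance Definition _ (X : topologicalZmodType) :=
  Topological.on (pointed_group X).
HB.instance Definition _ (X : topologicalZmodType) :=
  isPointed.Build (pointed_group X) (0 : X).

Notation borel X := (g_sigma_algebraType (@open (pointed_group X))).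

(* Regularity is automatic when [X] is metrizable. *)
Record is_haar (X : topologicalZmodType) (R : realType)
    (mu : probability (borel X) R) : Prop := IsHaar {
  haar_translation : forall (x : X) (B : set X),
    measurable (B : set (borel X)) -> mu [set x + y | y in B] = mu B;
  haar_outer_regular : forall B : set X,
    measurable (B : set (borel X)) ->
    mu B = ereal_inf [set mu U | U in [set U : set X | open U /\ B `<=` U]];
  haar_inner_regular : forall U : set X, open U ->
    mu U = ereal_sup [set mu K | K in [set K : set X | compact K /\ K `<=` U]] }.

Definition ergodic (X : topologicalZmodType) (R : realType)
    (mu : probability (borel X) R) (alpha : automorphism X) : Prop :=
  forall B : set X, measurable (B : set (borel X)) -> alpha @^-1` B = B ->
    mu B = 0%E \/ mu B = 1%E.

(* Main.v *)
Require Import Defs.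
From HB Require Import structures.
From mathcomp Require Import all_boot all_order all_algebra.
From mathcomp Require Import all_classical all_reals all_analysis.
From mathcomp Require Import finmap measurable_realfun spectral complex.
From mathcomp Require Import ring lra zify.

Set Implicit Arguments.
Unset Strict Implicit.
Unset Printing Implicit Defensive.

Import Order.TTheory GRing.Theory Num.Theory.
Import numFieldNormedType.Exports.

Local Open Scope classical_set_scope.
Local Open Scope ring_scope.

(** The statement reduces to the triviality of homoclinic points: if a point of
    [X] tends to [0] under the iterates of [alpha] in both time directions, then it
    is [0] ([homoclinic_trivial]). Granting this, let [Phi] be the induced
    equivariant map on a shift of finite type that covers [Y]. Asymptotic points
    have the same image, as the difference of their images is homoclinic. In a
    given point [z] every long enough word contains a loop, and repeating loops
    produces many points asymptotic to each other: inserting copies of total length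
    [M] at any place, where [M] is a multiple of all possible loop lengths, gives
    the same image. Pushing the place of the insertion to the right, then to the
    left, shows that this image is [Phi z], and that [Phi z] is fixed by the [M]-th
    iterate of [alpha]. With a very long insertion, a translate of the new point is
    close to a periodic point; hence [Phi z] is the image of one of the finitely
    many points of a fixed period ([insert_invariant],
    [finite_type_image_finite]).

    For homoclinic points one needs a nontrivial character of [X]. It comes from
    the Haar integral: convolution with an even continuous kernel of mean zero is a
    compact self-adjoint operator, so it has a nonzero eigenfunction
    ([exists_eigenfunction]) and a finite-dimensional eigenspace ([eigen_basis]),
    on which translations have a common eigenvector; the eigenvalue is the
    character ([exists_character]).

    Irreducibility forces an integral polynomial relation between the characters
    [theta], [theta \o alpha], [theta \o alpha^2] and so on. Were they independent,
    their joint distribution would be that of independent uniform variables, and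
    there would be an infinite proper closed invariant subgroup, of points along
    whose orbits the character is constant ([independent_not_irreducible]).

    Let [f] be a relation of least degree and [x] a homoclinic point. The angles
    along the orbit of [x] form a real sequence [u], tending to zero at both ends,
    and [f u] is an integral sequence, hence of finite support. A point [y] with a
    small orbit has an angle sequence [v] with [f v = 0] exactly, since the left
    side is integral and small. Then [(f u) * v = u * (f v) = 0], which is a
    relation satisfied by [y]; if it were not satisfied by all of [X], then by
    irreducibility only finitely many [y] would satisfy it, and [alpha] would be
    expansive ([reflect_relation]). So [f u], read as a polynomial, is a relation,
    therefore a multiple of [f] up to an integer factor [K]: [K f u = f h] with [h]
    integral of finite support. Now [K u - h] is a solution of the linear recurrence
    [f] that tends to zero at both ends, so it is zero
    ([vanishing_recurrence]), the character is trivial along the orbit of [K x],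
    and irreducibility gives [x = 0] ([no_homoclinic]). *)

(** * Pointwise continuity *)

Section pointwise_continuity.
Context (T : topologicalType).

Lemma cts_const (U : topologicalType) (a : U) : continuous ((fun=> a) : T -> U).
Proof. by move=> ?; exact: cvg_cst. Qed.

Lemma cts_comp (U V : topologicalType) (f : T -> U) (g : U -> V) :
  continuous f -> continuous g -> continuous (fun x => g (f x)).
Proof. by move=> cf cg x; apply: continuous_comp; [exact: cf|exact: cg]. Qed.

Lemma cts_addX (X : topologicalZmodType) (f g : T -> X) :
  continuous f -> continuous g -> continuous (fun x => f x + g x).
Proof.
move=> cf cg x; apply: (@continuous_comp _ _ _ (fun x => (f x, g x))
  (fun z : X * X => z.1 + z.2)); last exact: add_continuous.
by apply: cvg_pair; [exact: cf|exact: cg].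
Qed.

Lemma cts_oppX (X : topologicalZmodType) (f : T -> X) :
  continuous f -> continuous (fun x => - f x).
Proof. by move=> cf; apply: (cts_comp cf); exact: opp_continuous. Qed.

Lemma cts_add (R : realType) (f g : T -> R) :
  continuous f -> continuous g -> continuous (fun x => f x + g x).
Proof. by move=> cf cg x; apply: cvgD; [exact: cf|exact: cg]. Qed.

Lemma cts_opp (R : realType) (f : T -> R) :
  continuous f -> continuous (fun x => - f x).
Proof. by move=> cf x; apply: cvgN; exact: cf. Qed.

Lemma cts_sub (R : realType) (f g : T -> R) :
  continuous f -> continuous g -> continuous (fun x => f x - g x).
Proof. by move=> cf cg x; apply: cvgB; [exact: cf|exact: cg]. Qed.

Lemma cts_mul (R : realType) (f g : T -> R) :
  continuous f -> continuous g -> continuous (fun x => f x * g x).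
Proof. by move=> cf cg x; apply: cvgM; [exact: cf|exact: cg]. Qed.

Lemma cts_exp (R : realType) (f : T -> R) n :
  continuous f -> continuous (fun x => f x ^+ n).
Proof.
move=> cf; elim: n => [|n ih]; first exact: cts_const.
by rewrite (_ : (fun x => _) = fun x => f x * f x ^+ n); [exact: cts_mul|
  apply/funext => x; rewrite exprS].
Qed.

Lemma cts_norm (R : realType) (f : T -> R) :
  continuous f -> continuous (fun x => `|f x|).
Proof. by move=> cf x; apply: cvg_norm; exact: cf. Qed.

Lemma cts_sum (R : realType) (K : Type) (r : seq K) (f : K -> T -> R) :
  (forall k, continuous (f k)) -> continuous (fun x => \sum_(k <- r) f k x).
Proof.
move=> cf; elim: r => [|k r ih].
  by under eq_fun do rewrite big_nil; exact: cts_const.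
by under eq_fun do rewrite big_cons; exact: cts_add.
Qed.

End pointwise_continuity.

Lemma cts_fst (T U : topologicalType) : continuous (fun z : T * U => z.1).
Proof. by move=> x; exact: cvg_fst. Qed.

Lemma cts_snd (T U : topologicalType) : continuous (fun z : T * U => z.2).
Proof. by move=> x; exact: cvg_snd. Qed.

Lemma cts_id (T : topologicalType) : continuous (fun x : T => x).
Proof. by move=> x; exact: cvg_id. Qed.

Lemma cts_pairr (T U : topologicalType) (x : T) :
  continuous (fun y : U => (x, y)).
Proof. by move=> y; apply: cvg_pair; [exact: cvg_cst|exact: cvg_id]. Qed.

(** Continuity of arithmetic expressions. The goal is matched on its shape, so
    that no higher-order unification against the lemmas above is attempted. *)
Ltac cts := repeat first [ assumption
  | match goal with H : forall _, continuous _ |- _ => exact: (H _) end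
  | lazymatch goal with
  | |- continuous (fun x => x) => exact: cts_id
  | |- continuous fst => exact: cts_fst
  | |- continuous snd => exact: cts_snd
  | |- continuous -%R => exact: opp_continuous
  | |- continuous (fun x => fst x) => exact: cts_fst
  | |- continuous (fun x => snd x) => exact: cts_snd
  | |- continuous (fun x => _ + _) => first [apply: cts_add | apply: cts_addX]
  | |- continuous (fun x => _ * _) => apply: cts_mul
  | |- continuous (fun x => _ ^+ _) => apply: cts_exp
  | |- continuous (fun x => - _) => first [apply: cts_opp | apply: cts_oppX]
  | |- continuous (fun x => `|_|) => apply: cts_norm
  | |- continuous (fun x => ?a) => exact: cts_const
  end ].

(** * The Haar integral of continuous functions *)

(** The integral is only ever applied to continuous functions, and these five
    properties are all that is used of it; Fubini's theorem and strict
    positivity follow from them on a compact group. *)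
Record invariant_mean (X : topologicalZmodType) (R : realType)
    (I : (X -> R) -> R) : Prop := InvariantMean {
  meanD : forall f g : X -> R, continuous f -> continuous g ->
    I (fun x => f x + g x) = I f + I g;
  meanZ : forall (a : R) (f : X -> R), continuous f ->
    I (fun x => a * f x) = a * I f;
  mean_le : forall f g : X -> R, continuous f -> continuous g ->
    (forall x, f x <= g x) -> I f <= I g;
  mean1 : I (fun=> 1) = 1;
  mean_shift : forall (f : X -> R) (a : X), continuous f ->
    I (fun x => f (x + a)) = I f }.

Section haar_mean.
Context (X : topologicalZmodType) (R : realType).
Hypothesis X_compact : compact [set: X].
Variable haar : probability (borel X) R.
Hypothesis haarP : is_haar haar.

Definition haar_mean (f : X -> R) : R := \int[haar]_(x in setT) f x.

Lemma continuous_borel_measurable (f : X -> R) :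
  continuous f -> measurable_fun [set: borel X] (f : borel X -> R).
Proof.
move=> /continuousP cf.
apply: (measurability _ (measurable_realfun.RGenOpens.measurableE R)).
move=> _ [_ [a [b ->] <-]]; rewrite setTI.
by apply: sub_sigma_algebra; apply: cf; exact: interval_open.
Qed.

Lemma continuous_bounded (f : X -> R) : continuous f ->
  exists2 M, 0 <= M & forall x, `|f x| <= M.
Proof.
move=> cf; have /compact_bounded[M [_ Mf]] : compact (f @` [set: X]).
  apply: continuous_compact => //; exact: continuous_subspaceT.
exists (`|M| + 1) => // x; apply: Mf; last by exists x.
by rewrite (le_lt_trans (ler_norm M))// ltrDl.
Qed.

Lemma continuous_integrable (f : X -> R) : continuous f ->
  haar.-integrable [set: borel X] (EFin \o f).
Proof.
move=> cf; have [M M0 Mf] := continuous_bounded cf.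
apply: measurable_bounded_integrable => //.
- by rewrite (le_lt_trans (probability_le1 _ _))// ltry.
- exact: continuous_borel_measurable.
- by exists M; split; [exact: num_real|move=> y My x _; exact: le_trans (Mf x) (ltW My)].
Qed.

(** The measure and its push-forward by a translation agree on measurable sets,
    so they have the same integral. *)
Lemma haar_mean_shift (f : X -> R) (a : X) : continuous f ->
  haar_mean (fun x => f (x + a)) = haar_mean f.
Proof.
move=> cf; pose s : borel X -> borel X := fun x => (x : X) + a.
have ms : measurable_fun [set: borel X] s.
  apply: (@measurability _ _ (borel X) (borel X) setT s (@open (pointed_group X))) => //.
  move=> _ [B oB <-]; rewrite setTI; apply: sub_sigma_algebra.
  have /continuousP cs : continuous (fun x : X => x + a) by cts.
  exact: cs.
have cfs : continuous (fun x => f (x + a)) by apply: (@cts_comp X X R _ f) => //; cts.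
rewrite /haar_mean /Rintegral; congr fine.
have := @integral_pushforward _ _ (borel X) (borel X) R s ms haar setT (EFin \o f).
rewrite preimage_setT => <- //.
- apply: eq_measure_integral => A mA _; rewrite /pushforward /=.
  rewrite -(haar_translation haarP (- a) mA); congr (haar _).
  apply/seteqP; split => x /=.
    by move=> ?; exists (x + a) => //; rewrite addrC addrK.
  by move=> [y /= ? <-]; rewrite /s addrC addNKr.
- by apply/measurable_EFinP; exact: continuous_borel_measurable.
- exact: (continuous_integrable cfs).
Qed.

Lemma haar_invariant_mean : invariant_mean haar_mean.
Proof.
split.
- by move=> f g cf cg; apply: RintegralD => //; exact: continuous_integrable.
- by move=> a f cf; apply: RintegralZl => //; exact: continuous_integrable.
- by move=> f g cf cg fg; apply: le_Rintegral => //; exact: continuous_integrable.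
- rewrite /haar_mean Rintegral_cst// mul1r.
  by have := probability_setT haar; rewrite /= => ->.
- exact: haar_mean_shift.
Qed.

End haar_mean.

(** * Uniform continuity and Fubini's theorem on a compact group *)

Section compact_group.
Context (X : topologicalZmodType) (R : realType).
Hypothesis X_compact : compact [set: X].

Lemma open_shift (U : set X) (t : X) : open U -> open [set x | U (x - t)].
Proof.
move=> oU; have cs : continuous (fun x : X => x - t) by cts.
by move/continuousP : cs; exact.
Qed.

Lemma finite_net (U : set X) : nbhs 0 U ->
  exists s : seq X, forall x, exists2 t, t \in s & U (x - t).
Proof.
move=> U0; have cX : cover_compact [set: pointed_group X].
  by rewrite -compact_cover.
have [|x _|D _ DX] := cX X setT (fun t => [set x : X | interior U (x - t)]).
- by move=> t _; apply: open_shift; exact: open_interior.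
- by exists x => //=; rewrite subrr.
- exists (enum_fset D) => x; have [t /= tD xt] := DX x I.
  by exists t => //; exact: interior_subset xt.
Qed.

(** Uniformity in both variables comes from covering [X * X] at once. *)
Lemma uniformly_continuous2 (F : X -> X -> R) :
  continuous (fun z : X * X => F z.1 z.2) -> forall e, 0 < e ->
  \forall u \near (0 : X), forall x y, `|F (x + u) y - F x y| < e.
Proof.
move=> cF e e0.
have XX : compact [set: X * X] by rewrite -setXTT; exact: compact_setX.
suff : \forall u \near (0 : X), [set: X * X] `<=`
    (fun z => `|F (z.1 + u) z.2 - F z.1 z.2| < e).
  by apply: filterS => u h x y; exact: (h (x, y)).
apply: ((compact_near_coveringP _).1 XX X (nbhs (0 : X))
  (fun u z => `|F (z.1 + u) z.2 - F z.1 z.2| < e)) => z _.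
have cG : continuous (fun w : (X * X) * X =>
    `|F (w.1.1 + w.2) w.1.2 - F w.1.1 w.1.2|).
  apply: cts_norm; apply: cts_sub.
    apply: (@cts_comp _ _ _ (fun w : (X * X) * X => (w.1.1 + w.2, w.1.2)) _ _ cF).
    move=> w; apply: cvg_pair.
      apply: (@cts_addX _ _ (fun w : (X * X) * X => w.1.1) snd); last exact: cts_snd.
      by apply: (@cts_comp _ _ _ fst fst); exact: cts_fst.
    by apply: (@cts_comp _ _ _ fst snd); [exact: cts_fst|exact: cts_snd].
  by apply: (@cts_comp _ _ _ fst _ (@cts_fst _ _) cF).
apply: (cG (z, 0) [set r | r < e]).
apply: open_nbhs_nbhs; split; first exact: open_lt.
by rewrite /= addr0 subrr normr0.
Qed.

Lemma uniformly_continuous1 (f : X -> R) : continuous f -> forall e, 0 < e ->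
  \forall u \near (0 : X), forall x, `|f (x + u) - f x| < e.
Proof.
move=> cf e e0; have := @uniformly_continuous2 (fun x _ => f x) _ e e0.
have cF : continuous (fun z : X * X => f z.1).
  by apply: (@cts_comp _ _ _ fst); [exact: cts_fst|].
move=> /(_ cF); apply: filterS => u h x; exact: (h x 0).
Qed.

Lemma continuous_shift0 (f : X -> R) :
  (forall e, 0 < e -> \forall u \near (0 : X), forall x, `|f (x + u) - f x| < e) ->
  continuous f.
Proof.
move=> uf x; apply/cvgrPdist_lt => e /uf fe.
have cs : continuous (fun y : X => y - x) by cts.
have := cs x; rewrite /continuous_at subrr => csx; have : \forall y \near x, forall z, `|f (z + (y - x)) - f z| < e.
  exact: csx _ fe.
by apply: filterS => y /= /(_ x); rewrite [x + _]addrC subrK distrC.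
Qed.

Section separation.
Hypothesis X_hausdorff : hausdorff_space X.

(** A compact Hausdorff space is completely regular. *)
Lemma exists_bump (U : set X) : nbhs 0 U ->
  exists k : X -> R, [/\ continuous k, forall x, 0 <= k x, k 0 = 1 &
    forall x, ~ U x -> k x = 0].
Proof.
move=> U0; have X1 := hausdorff_accessible X_hausdorff.
have sep : uniform_separator [set (0 : X)] (~` interior U).
  apply: (@normal_completely_regular R X (compact_normal X_hausdorff X_compact) X1).
    by apply: open_closedC; exact: open_interior.
  by apply.
have [f [cf rf f0 f1]] := (@uniform_separatorP _ R _ _).1 sep.
  exists (fun x => 1 - f x); split => //.
  - by apply: cts_sub => //; exact: cts_const.
  - move=> x; have /= := rf (f x); rewrite in_itv/= => /(_ _)/andP[|_ ?]; first by exists x.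
    by rewrite subr_ge0.
  - have /= -> := f0 (f 0); first by rewrite subr0.
    by exists 0.
  - move=> x Ux; have /= -> := f1 (f x); first by rewrite subrr.
    by exists x => //= /interior_subset.
Qed.
End separation.
Section mean.
Variable I : (X -> R) -> R.
Hypothesis IP : invariant_mean I.

Lemma mean_cst (c : R) : I (fun=> c) = c.
Proof.
rewrite -[RHS]mulr1 -(mean1 IP) -(meanZ IP); last exact: cts_const.
by congr I; apply/funext => x; rewrite mulr1.
Qed.

Lemma meanN (f : X -> R) : continuous f -> I (fun x => - f x) = - I f.
Proof.
move=> cf; have := meanZ IP (-1) cf; rewrite mulN1r => <-.
by congr I; apply/funext => x; rewrite mulN1r.
Qed.

Lemma meanB (f g : X -> R) : continuous f -> continuous g ->
  I (fun x => f x - g x) = I f - I g.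
Proof.
by move=> cf cg; rewrite (meanD IP)// ?meanN//; exact: cts_opp.
Qed.

Lemma mean_sum (K : Type) (r : seq K) (f : K -> X -> R) :
  (forall k, continuous (f k)) ->
  I (fun x => \sum_(k <- r) f k x) = \sum_(k <- r) I (f k).
Proof.
move=> cf; elim: r => [|k r ih].
  by under eq_fun do rewrite big_nil; rewrite big_nil mean_cst.
under eq_fun do rewrite big_cons.
by rewrite big_cons (meanD IP)// ?ih//; exact: cts_sum.
Qed.

Lemma mean_ge0 (f : X -> R) : continuous f -> (forall x, 0 <= f x) -> 0 <= I f.
Proof.
by move=> cf f0; rewrite -(mean_cst 0); apply: (mean_le IP) => //; exact: cts_const.
Qed.

Lemma mean_dist (f g : X -> R) (e : R) : continuous f -> continuous g ->
  (forall x, `|f x - g x| <= e) -> `|I f - I g| <= e.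
Proof.
move=> cf cg fg; rewrite -meanB// ler_norml.
have cfg : continuous (fun x => f x - g x) by exact: cts_sub.
apply/andP; split; [rewrite -[leLHS]mean_cst|rewrite -[leRHS]mean_cst];
  by apply: (mean_le IP) => //; [exact: cts_const|move=> x; have := fg x; rewrite ler_norml => /andP[]].
Qed.

Lemma cts_mean (F : X -> X -> R) : continuous (fun z : X * X => F z.1 z.2) ->
  continuous (fun x => I (F x)).
Proof.
move=> cF; have cF1 x : continuous (F x) by exact: (cts_comp (@cts_pairr X X x) cF).
apply: continuous_shift0 => e e0.
have e20 : 0 < e / 2 by rewrite divr_gt0.
apply: filterS (uniformly_continuous2 cF e20) => u Fu x.
rewrite (@le_lt_trans _ _ (e / 2)) ?ltr_pdivrMr ?ltr_pMr ?ltr1n//.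
by apply: mean_dist => // y; exact/ltW/Fu.
Qed.

(** Finitely many translates of [f] have a sum bounded below by a positive
    constant, and they all have the same mean. *)
Lemma mean_gt0 (f : X -> R) (a : X) : continuous f -> (forall x, 0 <= f x) ->
  0 < f a -> 0 < I f.
Proof.
move=> cf f0 fa.
have [|s sX] := @finite_net [set u | f a / 2 < f (a + u)].
  have fa2 : 0 < f a / 2 by rewrite divr_gt0.
  apply: filterS (uniformly_continuous1 cf fa2) => u /(_ a) /=.
  by rewrite ltr_norml => /andP[+ _]; lra.
have cft t : continuous (fun x => f (x + (a - t))).
  by apply: (@cts_comp X X R _ f) => //; cts.
have : f a / 2 <= I (fun x => \sum_(t <- s) f (x + (a - t))).
  rewrite -[leLHS]mean_cst; apply: (mean_le IP); [exact: cts_const|exact: cts_sum|].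
  move=> x; have [t ts /= xt] := sX x.
  rewrite (big_rem t)//= ler_wpDr ?sumr_ge0//; last by move: xt; rewrite addrCA; exact: ltW.
have -> : I (fun x => \sum_(t <- s) f (x + (a - t))) = \sum_(t <- s) I f.
  by rewrite mean_sum//; apply: eq_bigr => t _; exact: (mean_shift IP).
rewrite big_const_seq iter_addr addr0 => h.
rewrite lt_neqAle mean_ge0// andbT eq_sym; apply/eqP => If0.
by move: h; rewrite If0 mul0rn; lra.
Qed.

Lemma mean_sq_eq0 (f : X -> R) : continuous f -> I (fun x => f x ^+ 2) = 0 ->
  forall x, f x = 0.
Proof.
move=> cf If x; apply/eqP/negPn/negP => fx.
suff : 0 < I (fun x => f x ^+ 2) by rewrite If ltxx.
apply: (@mean_gt0 _ x); first by (under eq_fun do rewrite expr2); exact: cts_mul.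
  by move=> y; exact: sqr_ge0.
by rewrite lt_neqAle sqr_ge0 eq_sym sqrf_eq0 fx.
Qed.

(** With a partition of unity [p t] subordinate to the translates of a small
    neighbourhood, [F x y] is uniformly close to [\sum_t p t x * F t y], for
    which both orders of integration give the same value. *)
Lemma mean_fubini (F : X -> X -> R) : hausdorff_space X ->
  continuous (fun z : X * X => F z.1 z.2) ->
  I (fun x => I (F x)) = I (fun y => I (fun x => F x y)).
Proof.
move=> X_hausdorff cF.
have cF1 x : continuous (F x) by exact: (cts_comp (@cts_pairr X X x) cF).
have cF' : continuous (fun z : X * X => F z.2 z.1).
  apply: (@cts_comp _ _ _ (fun z : X * X => (z.2, z.1)) _ _ cF) => z.
  by apply: cvg_pair; [exact: cts_snd|exact: cts_fst].
have cF2 y : continuous (F^~ y) by exact: (cts_comp (@cts_pairr X X y) cF').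
have cIF := cts_mean cF.
have cIF' : continuous (fun y => I (F^~ y)) by exact: (cts_mean cF').
apply/eqP; rewrite -subr_eq0 -normr_eq0; apply/negPn/negP => Inz.
set d := `| _ | in Inz; have d0 : 0 < d by rewrite lt_neqAle eq_sym Inz normr_ge0.
have d30 : 0 < d / 3 by rewrite divr_gt0.
pose U := [set u | forall x y, `|F (x + u) y - F x y| < d / 3].
have U0 : nbhs (0 : X) U by exact: uniformly_continuous2.
have [k [ck k0 k01 kU]] := exists_bump X_hausdorff U0.
have [|s sX] := @finite_net [set u | 1 / 2 < k u].
  have h20 : 0 < (1 / 2 : R) by rewrite divr_gt0.
  apply: filterS (uniformly_continuous1 ck h20) => u /(_ 0) /=.
  by rewrite add0r k01 ltr_norml => /andP[+ _]; lra.
have ckt t : continuous (fun x => k (x - t)).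
  by apply: (@cts_comp X X R _ k) => //; cts.
pose S x := \sum_(t <- s) k (x - t).
have cS : continuous S by exact: cts_sum.
have S0 x : 0 < S x.
  have [t ts /= xt] := sX x; rewrite /S (big_rem t)//= ltr_wpDr ?sumr_ge0//.
  by rewrite (lt_trans _ xt)// divr_gt0.
pose p t x := k (x - t) / S x.
have cp t : continuous (p t).
  apply: cts_mul => // x; apply: cvgV; last exact: cS.
  by rewrite gt_eqF.
have p0 t x : 0 <= p t x by rewrite divr_ge0// ltW.
have p1 x : \sum_(t <- s) p t x = 1.
  by rewrite /p -mulr_suml divff// gt_eqF// S0.
have Fp x y : `|F x y - \sum_(t <- s) p t x * F t y| <= d / 3.
  set e := d / 3; rewrite -[F x y]mul1r -(p1 x) mulr_suml -sumrB.
  rewrite (le_trans (ler_norm_sum _ _ _))// -[leRHS]mul1r -(p1 x) mulr_suml.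
  apply: ler_sum => t _; rewrite -mulrBr normrM ger0_norm//.
  have [Ut|nU] := pselect (U (x - t)); last by rewrite /p kU// !mul0r.
  apply: ler_wpM2l => //; have := Ut t y; rewrite [t + _]addrC subrK.
  exact: ltW.
pose A := \sum_(t <- s) I (p t) * I (F t).
have h1 : `|I (fun x => I (F x)) - A| <= d / 3.
  have -> : A = I (fun x => \sum_(t <- s) I (F t) * p t x).
    rewrite mean_sum; last by move=> t; apply: cts_mul => //; exact: cts_const.
    by apply: eq_bigr => t _; rewrite (meanZ IP)// mulrC.
  apply: mean_dist => //.
    by apply: cts_sum => t; apply: cts_mul => //; exact: cts_const.
  move=> x; have -> : \sum_(t <- s) I (F t) * p t x = I (fun y => \sum_(t <- s) p t x * F t y).
    rewrite mean_sum; last by move=> t; apply: cts_mul => //; exact: cts_const.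
    by apply: eq_bigr => t _; rewrite (meanZ IP)// mulrC.
  apply: mean_dist => //.
  by apply: cts_sum => t; apply: cts_mul => //; exact: cts_const.
have h2 : `|I (fun y => I (F^~ y)) - A| <= d / 3.
  have -> : A = I (fun y => \sum_(t <- s) I (p t) * F t y).
    rewrite mean_sum; last by move=> t; apply: cts_mul => //; exact: cts_const.
    by apply: eq_bigr => t _; rewrite (meanZ IP).
  apply: mean_dist => //.
    by apply: cts_sum => t; apply: cts_mul => //; exact: cts_const.
  move=> y; have -> : \sum_(t <- s) I (p t) * F t y = I (fun x => \sum_(t <- s) F t y * p t x).
    rewrite mean_sum; last by move=> t; apply: cts_mul => //; exact: cts_const.
    by apply: eq_bigr => t _; rewrite (meanZ IP)// mulrC.
  apply: mean_dist => //.
    by apply: cts_sum => t; apply: cts_mul => //; exact: cts_const.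
  by move=> x; under eq_bigr do rewrite mulrC; exact: Fp.
have : d <= d / 3 + d / 3.
  rewrite {1}/d; set a := I _; set b := I _.
  have -> : a - b = (a - A) - (b - A) by ring.
  by rewrite (le_trans (ler_normB _ _))// lerD.
by lra.
Qed.

End mean.
End compact_group.

(** * Inner product and convolution *)

Section inner_product.
Context (X : topologicalZmodType) (R : realType).
Hypothesis X_compact : compact [set: X].
Variable I : (X -> R) -> R.
Hypothesis IP : invariant_mean I.

Definition ip (u v : X -> R) : R := I (fun x => u x * v x).

Lemma ipC u v : ip u v = ip v u.
Proof. by congr I; apply/funext => x; rewrite mulrC. Qed.

Lemma ip_linear a b (u v w : X -> R) :
  continuous u -> continuous v -> continuous w ->
  ip (fun x => a * u x + b * v x) w = a * ip u w + b * ip v w.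
Proof.
move=> cu cv cw; rewrite /ip -!(meanZ IP); [|cts..].
rewrite -(meanD IP); [|cts..].
by congr I; apply/funext => x; ring.
Qed.

Lemma ip_ge0 (u : X -> R) : continuous u -> 0 <= ip u u.
Proof. by move=> cu; apply: (mean_ge0 IP); [cts|move=> x; rewrite -expr2 sqr_ge0]. Qed.

Lemma ip_eq0 (u : X -> R) : continuous u -> ip u u = 0 -> forall x, u x = 0.
Proof. by move=> cu u0; apply: (mean_sq_eq0 X_compact IP) => //. Qed.

Lemma ip_gt0 (u : X -> R) a : continuous u -> u a != 0 -> 0 < ip u u.
Proof.
move=> cu; apply: contraNT; rewrite -leNgt => u0; apply/eqP; apply: ip_eq0 => //.
by apply/eqP; rewrite eq_le u0 ip_ge0.
Qed.

Lemma ip_sq (a b : R) (u v : X -> R) : continuous u -> continuous v ->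
  ip (fun x => a * u x + b * v x) (fun x => a * u x + b * v x) =
  a ^+ 2 * ip u u + 2 * a * b * ip u v + b ^+ 2 * ip v v.
Proof.
move=> cu cv.
have cw : continuous (fun x => a * u x + b * v x) by cts.
rewrite ip_linear// ipC [ip v _]ipC !ip_linear// [ip v u]ipC; ring.
Qed.

Lemma ip_scale (a : R) (u : X -> R) : continuous u ->
  ip (fun x => a * u x) (fun x => a * u x) = a ^+ 2 * ip u u.
Proof.
move=> cu; rewrite /ip -(meanZ IP); last by cts.
by congr I; apply/funext => x; ring.
Qed.

Lemma cauchy_schwarz (u v : X -> R) : continuous u -> continuous v ->
  ip u v ^+ 2 <= ip u u * ip v v.
Proof.
move=> cu cv; have [v0|] := eqVneq (ip v v) 0.
  have -> : ip u v = 0.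
    rewrite /ip (_ : (fun x => _) = fun=> 0) ?(mean_cst IP)//.
    by apply/funext => x; rewrite (ip_eq0 cv v0) mulr0.
  by rewrite v0 mulr0 expr0n.
move=> vn0; have vp : 0 < ip v v by rewrite lt_neqAle eq_sym vn0 ip_ge0.
have cw : continuous (fun x => ip v v * u x + (- ip u v) * v x) by cts.
have := ip_ge0 cw; rewrite ip_sq// => h.
rewrite -subr_ge0 -(pmulr_rge0 _ vp).
by apply: le_trans h _; rewrite le_eqVlt; apply/orP; left; apply/eqP; ring.
Qed.

Lemma ip_le (u : X -> R) (M : R) : continuous u -> (forall x, `|u x| <= M) ->
  ip u u <= M ^+ 2.
Proof.
move=> cu uM; rewrite -[leRHS](mean_cst IP); apply: (mean_le IP); [cts..|].
move=> x; rewrite -expr2 -real_normK ?num_real//; apply: lerXn2r; rewrite ?nnegrE//.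
exact: le_trans (uM x).
Qed.

Section convolution.
Hypothesis X_hausdorff : hausdorff_space X.
Variable p : X -> R.
Hypothesis cp : continuous p.
Hypothesis p_even : forall x, p (- x) = p x.

Definition conv (u : X -> R) (x : X) : R := I (fun y => p (x - y) * u y).

Let cpd : continuous (fun z : X * X => p (z.1 - z.2)).
Proof. by apply: (@cts_comp _ _ _ (fun z : X * X => z.1 - z.2) _ _ cp); cts. Qed.

Let cpx (x : X) : continuous (fun y => p (x - y)).
Proof. by apply: (@cts_comp _ _ _ (fun z : X => x - z) _ _ cp); cts. Qed.

Lemma cts_conv u : continuous u -> continuous (conv u).
Proof.
move=> cu; apply: (@cts_mean _ _ X_compact _ IP (fun x y => p (x - y) * u y)).
apply: cts_mul => //. exact: (cts_comp (@cts_snd X X) cu).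
Qed.

Lemma conv_linear a b (u v : X -> R) x : continuous u -> continuous v ->
  conv (fun x => a * u x + b * v x) x = a * conv u x + b * conv v x.
Proof.
move=> cu cv; rewrite /conv -!(meanZ IP); [|by cts..].
rewrite -(meanD IP); [|by cts..].
by congr I; apply/funext => y; ring.
Qed.

Lemma conv_scale a (u : X -> R) : continuous u ->
  conv (fun x => a * u x) = fun x => a * conv u x.
Proof.
move=> cu; apply/funext => x; rewrite /conv -(meanZ IP); last by cts.
by congr I; apply/funext => y; ring.
Qed.

(** Convolution commutes with translations: this is what makes its eigenspaces
    invariant under the group. *)
Lemma conv_shift u a x : continuous u ->
  conv (fun y => u (y + a)) x = conv u (x + a).
Proof.
move=> cu; rewrite /conv -[RHS](mean_shift IP a); last by cts.
by congr I; apply/funext => y; congr (p _ * _); rewrite opprD addrACA subrr addr0.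
Qed.

(** Fubini's theorem, with an even kernel. *)
Lemma conv_selfadjoint u v : continuous u -> continuous v -> ip (conv u) v = ip u (conv v).
Proof.
move=> cu cv; rewrite /ip.
transitivity (I (fun x => I (fun y => p (x - y) * u y * v x))).
  congr I; apply/funext => x; rewrite mulrC /conv -(meanZ IP); last by cts.
  by congr I; apply/funext => y; ring.
rewrite (mean_fubini X_compact IP X_hausdorff); last first.
  apply: cts_mul; first apply: cts_mul => //.
    exact: (cts_comp (@cts_snd X X) cu).
  exact: (cts_comp (@cts_fst X X) cv).
congr I; apply/funext => y; rewrite /conv -(meanZ IP); last by cts.
by congr I; apply/funext => x; rewrite -p_even opprB; ring.
Qed.

(** The values of [conv u] are inner products of [u] with translates of [p]; a
    bound of the uniform norm by the quadratic norm is the smoothing property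
    behind compactness. *)
Lemma conv_sup u x : continuous u -> conv u x ^+ 2 <= ip p p * ip u u.
Proof.
move=> cu; rewrite (le_trans (cauchy_schwarz _ _))//; apply: ler_wpM2r; first exact: ip_ge0.
rewrite le_eqVlt; apply/orP; left; apply/eqP.
rewrite -[LHS](mean_shift IP x); last by cts.
by congr I; apply/funext => y; rewrite opprD addrCA subrr addr0 p_even.
Qed.

(** The modulus of continuity of [conv u] is that of [p], uniformly over the unit
    ball: the hypothesis of an Ascoli argument. *)
Lemma conv_equicontinuous u v e : continuous u -> ip u u <= 1 -> 0 <= e ->
  (forall x, `|p (x + v) - p x| <= e) ->
  forall x, `|conv u (x + v) - conv u x| <= e.
Proof.
move=> cu u1 e0 pe x.
have cq : continuous (fun y => p (x + v - y) - p (x - y)).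
  by apply: cts_sub => //; exact: cpx.
have -> : conv u (x + v) - conv u x = ip (fun y => p (x + v - y) - p (x - y)) u.
  rewrite /conv -(meanB IP); [|by cts..].
  by congr I; apply/funext => y; rewrite mulrBl.
rewrite -[leRHS]ger0_norm// -ler_sqr ?nnegrE ?normr_ge0//.
rewrite !real_normK ?num_real// (le_trans (cauchy_schwarz cq cu))//.
rewrite -[leRHS]mulr1 ler_pM//; [exact: ip_ge0..|].
by apply: ip_le => // y; rewrite addrAC.
Qed.

Lemma conv_bound u M e : continuous u -> (forall x, `|p x| <= M) ->
  (forall x, `|u x| <= e) -> forall x, `|conv u x| <= M * e.
Proof.
move=> cu pM ue x.
have := @mean_dist _ _ _ IP (fun y => p (x - y) * u y) (fun=> 0) (M * e).
rewrite (mean_cst IP) subr0; apply; [by cts|exact: cts_const|].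
by move=> y; rewrite subr0 normrM ler_pM.
Qed.

End convolution.
End inner_product.

(** * Existence of an eigenfunction of a convolution operator *)

Section eigenfunction.
Context (X : topologicalZmodType) (R : realType).
Hypothesis X_compact : compact [set: X].
Hypothesis X_hausdorff : hausdorff_space X.
Variable I : (X -> R) -> R.
Hypothesis IP : invariant_mean I.
Variable p : X -> R.
Hypothesis cp : continuous p.
Hypothesis p_even : forall x, p (- x) = p x.
Hypothesis p_neq0 : exists a, p a != 0.

Local Notation P := (conv I p).

Let cP u : continuous u -> continuous (P u).
Proof. exact: (cts_conv X_compact IP cp). Qed.

(** [lam] is the square of the operator norm of the convolution operator [P]; it
    is positive because [P p 0] is the squared norm of [p]. *)
Lemma conv_norm : exists2 lam : R, 0 < lam &
  (forall u, continuous u -> ip I (P u) (P u) <= lam * ip I u u) /\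
  (forall e, 0 < e -> exists u, [/\ continuous u, ip I u u = 1 &
     lam - e < ip I (P u) (P u)]).
Proof.
pose C := ip I p p.
have C_gt0 : 0 < C by have [a pa] := p_neq0; exact: (ip_gt0 X_compact IP cp pa).
pose S := [set r : R | exists u, [/\ continuous u, ip I u u = 1 &
  r = ip I (P u) (P u)]].
have normalize u : continuous u -> 0 < ip I u u ->
    S (ip I (P u) (P u) / ip I u u).
  move=> cu u0; pose c := (Num.sqrt (ip I u u))^-1.
  have cE : c ^+ 2 = (ip I u u)^-1 by rewrite exprVn sqr_sqrtr// ltW.
  exists (fun x => c * u x); split.
  - by cts.
  - by rewrite (ip_scale IP)// cE mulVf// gt_eqF.
  - rewrite (conv_scale IP cp)// (ip_scale IP) ?cE 1?mulrC//; exact: cP.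
have SC r : S r -> r <= C ^+ 1.
  move=> [u [cu u1 ->]]; rewrite -[leRHS](mean_cst IP).
  apply: (mean_le IP); [by apply: cts_mul; exact: cP|exact: cts_const|].
  move=> x; rewrite -expr2 expr1 -[leRHS]mulr1 -u1.
  exact: (conv_sup X_compact IP cp p_even).
have [a pa] := p_neq0.
have Pp0 : 0 < ip I (P p) (P p).
  apply: (ip_gt0 X_compact IP (a := 0)); first exact: cP.
  rewrite /conv (_ : I _ = C) ?gt_eqF//; congr I; apply/funext => y.
  by rewrite sub0r p_even.
have S0 : S (ip I (P p) (P p) / C) by exact: normalize.
have hS : has_sup S.
  by split; [exists (ip I (P p) (P p) / C)|exists (C ^+ 1) => r /SC].
exists (sup S).
  by rewrite (lt_le_trans _ (ub_le_sup hS.2 S0))// divr_gt0.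
split.
  move=> u cu; have [u0|un0] := eqVneq (ip I u u) 0.
    have -> : P u = fun=> 0.
      apply/funext => x; rewrite /conv (_ : (fun y => _) = fun=> 0) ?(mean_cst IP)//.
      by apply/funext => y; rewrite (ip_eq0 X_compact IP cu u0) mulr0.
    by rewrite u0 mulr0 /ip (_ : (fun x => _) = fun=> 0) ?(mean_cst IP)//; apply/funext => x; rewrite mulr0.
  have u0 : 0 < ip I u u by rewrite lt_neqAle eq_sym un0 (ip_ge0 IP).
  by rewrite -ler_pdivrMr//; apply: (ub_le_sup hS.2); exact: normalize.
move=> e e0; have [r [u [cu u1 ->]] ur] := sup_adherent e0 hS.
by exists u.
Qed.

(** A cluster point of [h] for pointwise convergence, by Tychonoff's theorem. As
    the group need not be metrizable there may be no convergent subsequence, but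
    approximation on finite sets is enough. *)
Lemma finite_approximation (h : nat -> X -> R) (M : R) :
  (forall n x, `|h n x| <= M) ->
  exists g : X -> R, forall (s : seq X) e n0, 0 < e ->
    exists2 n, (n0 <= n)%N & forall x, x \in s -> `|h n x - g x| < e.
Proof.
move=> hM.
have K := @tychonoff X (fun=> R) (fun=> `[- M, M]%classic)
  (fun=> @segment_compact R (- M) M).
pose F := (h : nat -> prod_topology (fun _ : X => R)) @ \oo.
have [|g [_ gc]] := K F _.
  exists 0%N => // n _ x /=; rewrite in_itv/= -ler_norml; exact: hM.
exists g => s e n0 e0.
pose G : prod_topology (fun _ : X => R) := g.
have gs : nbhs G [set f | forall x, x \in s -> `|f x - g x| < e].
  elim: s => [|t s ih].
    have -> : [set f : prod_topology (fun _ : X => R) |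
      forall x, x \in [::] -> `|f x - g x| < e] = setT by apply/seteqP; split.
    exact: (@filterT _ (nbhs G)).
  have ht : nbhs G [set f | `|f t - g t| < e].
    have ge : nbhs (g t) [set r : R | `|r - g t| < e].
      by have := nbhsx_ballx (g t) e e0; apply: filterS => r; rewrite /ball /= distrC.
    exact: (@proj_continuous X (fun=> R) t G _ ge).
  apply: (@filterS2 _ (nbhs G) _ _ _ _ _ ht ih) => f ft fs x.
  by rewrite inE => /predU1P[->//|]; exact: fs.
have hn0 : F (h @` [set n | (n0 <= n)%N]) by exists n0 => // n; exists n.
have [_ [[n n0n <-] hn]] := gc _ _ hn0 gs.
by exists n.
Qed.

(** The spectral theorem for the compact self-adjoint operator [P ^ 2]. Take unit
    vectors [u n] with [|P (u n)|^2] close to the squared norm [lam] of [P]; then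
    [|P (P (u n)) - lam * u n|^2 <= 2 * lam * (lam - |P (u n)|^2)] is small. The
    functions [P (u n)] are equicontinuous, so some of them are uniformly close
    to a function [g], for which the quasi-eigenvector equation becomes exact. *)
Lemma exists_eigenfunction : exists2 lam : R, 0 < lam &
  exists g, [/\ continuous g, exists x, g x != 0 &
    forall x, P (P g) x = lam * g x].
Proof.
have [lam lam0 [Pl Pa]] := conv_norm.
pose e n : R := lam / n.+2%:R.
have e0 n : 0 < e n by rewrite divr_gt0.
have [u uP] := choice (fun n => Pa (e n) (e0 n)).
have cu n : continuous (u n) by have [] := uP n.
have u1 n : ip I (u n) (u n) = 1 by have [] := uP n.
pose h n := P (u n); have ch n : continuous (h n) by exact: cP.
pose C := ip I p p; have C0 : 0 <= C by exact: (ip_ge0 IP).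
have [M M0 pM] := continuous_bounded X_compact cp.
have hC n x : `|h n x| <= C + 1.
  have := conv_sup X_compact IP cp p_even x (cu n); rewrite u1 mulr1 -/C -/(h n) => hC.
  rewrite -ler_sqr ?nnegrE ?addr_ge0// real_normK ?num_real//.
  by apply: le_trans hC _; nra.
have equi d : 0 < d ->
    \forall v \near (0 : X), forall n x, `|h n (x + v) - h n x| <= d.
  move=> d0; apply: filterS (uniformly_continuous1 X_compact cp d0) => v pv n x.
  apply: (conv_equicontinuous X_compact IP cp) => //; first by rewrite u1.
    exact: ltW.
  by move=> y; exact/ltW/pv.
have [g gP] := finite_approximation hC.
have gequi d v : 0 < d -> (forall n x, `|h n (x + v) - h n x| <= d) ->
    forall x, `|g (x + v) - g x| <= 3 * d.
  move=> d0 hv x; have [n _ gn] := gP [:: x + v; x] d 0%N d0.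
  have := gn x; have := gn (x + v); rewrite !inE !eqxx orbT => /(_ isT) + /(_ isT).
  have := hv n x; rewrite !ltr_norml !ler_norml => /andP[? ?] /andP[? ?] /andP[? ?].
  by apply/andP; split; lra.
have cg : continuous g.
  apply: continuous_shift0 => d d0; have d40 : 0 < d / 4 by rewrite divr_gt0.
  apply: filterS (equi _ d40) => v hv x; apply: le_lt_trans (gequi _ _ d40 hv x) _.
  lra.
have unif d n0 : 0 < d -> exists2 n, (n0 <= n)%N & forall x, `|h n x - g x| <= d.
  move=> d0; have d50 : 0 < d / 5 by rewrite divr_gt0.
  have [s sX] := finite_net X_compact (equi _ d50).
  have [n n0n gn] := gP s _ n0 d50; exists n => // x.
  have [t ts xt] := sX x; have := gequi _ _ d50 xt t; have := xt n t.
  have := gn t ts; rewrite [t + _]addrC subrK.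
  rewrite !ltr_norml !ler_norml => /andP[? ?] /andP[? ?] /andP[? ?].
  by apply/andP; split; lra.
exists lam => //; exists g; split => //.
  apply: contrapT => g0; have g00 x : g x = 0.
    by apply/eqP/negPn/negP => gx; apply: g0; exists x.
  pose d := Num.min 1 (lam / 2); have d0 : 0 < d by rewrite lt_min ltr01 divr_gt0.
  have [n _ hn] := unif d 0%N d0.
  have := ip_le IP (ch n) (M := d); rewrite -/(h n).
  have hd x : `|h n x| <= d by have := hn x; rewrite g00 subr0.
  move=> /(_ hd); apply/negP; rewrite -ltNge.
  have [_ _ un] := uP n; apply: le_lt_trans un.
  have d1 : d <= 1 by rewrite ge_min lexx.
  have d2 : d <= lam / 2 by rewrite ge_min lexx orbT.
  have : e n <= lam / 2 by rewrite ler_pM2l// lef_pV2 ?posrE// ler_nat.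
  move=> en; have dd : d ^+ 2 <= d by nra.
  by lra.
(* [P] is self-adjoint, and [|P (P (u n))|^2 <= lam * |P (u n)|^2] *)
have quasi n : ip I (fun x => 1 * P (P (u n)) x + (- lam) * u n x)
    (fun x => 1 * P (P (u n)) x + (- lam) * u n x) <= lam * e n.
  rewrite (ip_sq IP)//; last by apply/cP/cP.
  rewrite u1 (conv_selfadjoint X_compact IP X_hausdorff cp p_even (cP (cu n)) (cu n)).
  have [_ _ un] := uP n; have := Pl (P (u n)) (cP (cu n)).
  set q := ip I (P (u n)) (P (u n)) in un *; set r := ip _ _ _ => rq.
  have : lam * (lam - q) <= lam * e n by rewrite ler_pM2l//; lra.
  by move=> ?; nra.
move=> x; apply/eqP; rewrite -subr_eq0 -normr_eq0; apply/negPn/negP.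
set d := `| _ |; move=> dn0.
have d0 : 0 < d by rewrite lt_neqAle eq_sym dn0 normr_ge0.
(* the error is at most [K * t + d / 4 = d / 2 < d], with [t] chosen below *)
pose K := M * M + lam; have K0 : 0 < K by rewrite ltr_wpDl// mulr_ge0.
have K40 : 0 < d / (4 * K) by rewrite divr_gt0// mulr_gt0.
pose B := C * lam * lam; have B0 : 0 <= B by rewrite !mulr_ge0// ltW.
pose n0 := Num.bound (B / (d / 4) ^+ 2).
have [n n0n hn] := unif _ n0 K40; set t := d / (4 * K) in K40 hn.
have cgh : continuous (fun x => 1 * g x + (- 1) * h n x) by cts.
have gh y : `|1 * g y + (-1) * h n y| <= t by rewrite mul1r mulN1r distrC.
have h1 : `|P (P (fun x => 1 * g x + (- 1) * h n x)) x| <= M * (M * t).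
  apply: (conv_bound IP cp) => //; first exact: cP.
  by move=> y; exact: (conv_bound IP cp).
have PPlin y : P (P (fun x => 1 * g x + (- 1) * h n x)) y = P (P g) y - P (P (h n)) y.
  have -> : P (fun x => 1 * g x + (- 1) * h n x) = fun x => 1 * P g x + (- 1) * P (h n) x.
    by apply/funext => z; rewrite (conv_linear IP cp).
  by rewrite (conv_linear IP cp) ?mul1r ?mulN1r//; exact: cP.
have cq : continuous (fun x => 1 * P (P (u n)) x + (- lam) * u n x).
  by cts; exact/cP/cP.
have h2 : `|P (P (h n)) x - lam * h n x| < d / 4.
  have d40 : 0 <= d / 4 by rewrite divr_ge0// ltW.
  rewrite -ltr_sqr ?nnegrE// real_normK ?num_real//.
  have -> : P (P (h n)) x - lam * h n x = P (fun x => 1 * P (P (u n)) x + (- lam) * u n x) x.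
    by rewrite (conv_linear IP cp) ?mul1r ?mulNr//; exact/cP/cP.
  apply: le_lt_trans (conv_sup X_compact IP cp p_even x cq) _.
  have : C * ip I (fun x => 1 * P (P (u n)) x + (- lam) * u n x)
    (fun x => 1 * P (P (u n)) x + (- lam) * u n x) <= C * (lam * e n).
    by apply: ler_wpM2l => //; exact: quasi.
  move=> /le_lt_trans; apply.
  have -> : C * (lam * e n) = B / n.+2%:R by rewrite /B /e; ring.
  have d2 : 0 < (d / 4) ^+ 2 by rewrite exprn_gt0// divr_gt0.
  rewrite ltr_pdivrMr// mulrC -ltr_pdivrMr//.
  have := archi_boundP (divr_ge0 B0 (ltW d2)); move=> /lt_trans; apply.
  by rewrite ltr_nat ltnS (leq_trans n0n)// leqnSn.
have Kt : K * t = d / 4 by rewrite /t; field; rewrite gt_eqF.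
have : d <= `|P (P g) x - P (P (h n)) x| + `|P (P (h n)) x - lam * h n x|
    + lam * `|h n x - g x|.
  have -> : lam * `|h n x - g x| = `|lam * (h n x - g x)|.
    by rewrite normrM (gtr0_norm lam0).
  rewrite /d.
  have -> : P (P g) x - lam * g x = P (P g) x - P (P (h n)) x +
    (P (P (h n)) x - lam * h n x) + lam * (h n x - g x) by ring.
  by apply: le_trans (ler_normD _ _) _; apply: lerD => //; exact: ler_normD.
rewrite -PPlin; have := hn x; set a := `|h n x - g x|; set b := `|P _ x| in h1 *.
set c := `| _ - _| in h2 *; move=> at_ dabc.
have : lam * a <= lam * t by rewrite ler_pM2l.
by rewrite /K in Kt; nra.
Qed.
End eigenfunction.

(** * Eigenspaces are finite-dimensional *)

Lemma bounded_maximum (P : nat -> Prop) (b : nat) : P 0%N ->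
  (forall n, P n -> (n <= b)%N) -> exists2 n, P n & ~ P n.+1.
Proof.
move=> P0 Pb; apply: contrapT => nP.
have PS n : P n by elim: n => // n Pn; apply: contrapT => nPn; apply: nP; exists n.
by have := Pb _ (PS b.+1); rewrite ltnn.
Qed.

Section eigenspace.
Context (X : topologicalZmodType) (R : realType).
Hypothesis X_compact : compact [set: X].
Hypothesis X_hausdorff : hausdorff_space X.
Variable I : (X -> R) -> R.
Hypothesis IP : invariant_mean I.
Variable p : X -> R.
Hypothesis cp : continuous p.
Hypothesis p_even : forall x, p (- x) = p x.

Local Notation P := (conv I p).

Let cP u : continuous u -> continuous (P u).
Proof. exact: (cts_conv X_compact IP cp). Qed.

Lemma ip_sum (k : nat) (a : nat -> R) (f : nat -> X -> R) (w : X -> R) :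
  (forall i, continuous (f i)) -> continuous w ->
  ip I (fun x => \sum_(i < k) a i * f i x) w = \sum_(i < k) a i * ip I (f i) w.
Proof.
move=> cf cw; rewrite /ip.
transitivity (I (fun x => \sum_(i < k) a i * (f i x * w x))).
  by congr I; apply/funext => x; rewrite mulr_suml; apply: eq_bigr => i _; ring.
rewrite (mean_sum IP); last by move=> i; cts.
by apply: eq_bigr => i _; rewrite (meanZ IP)//; cts.
Qed.

Definition orthonormal (k : nat) (f : nat -> X -> R) :=
  forall i j, (i < k)%N -> (j < k)%N -> ip I (f i) (f j) = (i == j)%:R.

Lemma ip_orthonormal_sum k (a : nat -> R) f j : (forall i, continuous (f i)) ->
  orthonormal k f -> (j < k)%N ->
  ip I (fun x => \sum_(i < k) a i * f i x) (f j) = a j.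
Proof.
move=> cf of_ jk; rewrite ip_sum// (bigD1 (Ordinal jk))//= of_// eqxx mulr1.
rewrite big1 ?addr0// => i ij; rewrite of_// (_ : (i == j :> nat) = false) ?mulr0//.
by apply: contra_neqF ij => /eqP ij; apply: val_inj.
Qed.

(** The squared distance from [w] to its projection is nonnegative. *)
Lemma bessel k f w : (forall i, continuous (f i)) -> continuous w ->
  orthonormal k f -> \sum_(i < k) ip I w (f i) ^+ 2 <= ip I w w.
Proof.
move=> cf cw of_; pose a i := ip I w (f i).
pose s x := \sum_(i < k) a i * f i x.
have cs : continuous s by apply: cts_sum => i; cts.
have sw : ip I s w = \sum_(i < k) a i ^+ 2.
  by rewrite ip_sum//; apply: eq_bigr => i _; rewrite ipC.
have ss : ip I s s = \sum_(i < k) a i ^+ 2.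
  rewrite ip_sum//; apply: eq_bigr => i _.
  by rewrite ipC /s ip_orthonormal_sum.
have cd : continuous (fun x => 1 * w x + (-1) * s x) by cts.
have := ip_ge0 IP cd; rewrite (ip_sq IP)// ipC sw ss -/a; lra.
Qed.

Variable lam : R.
Hypothesis lam0 : 0 < lam.

Definition eigen (f : X -> R) : Prop :=
  continuous f /\ forall x, P (P f) x = lam * f x.

Lemma eigen_comb a b f g : eigen f -> eigen g ->
  eigen (fun x => a * f x + b * g x).
Proof.
move=> [cf fE] [cg gE]; split; first by cts.
move=> x; have -> : P (fun x => a * f x + b * g x) = fun x => a * P f x + b * P g x.
  by apply/funext => z; rewrite (conv_linear IP cp).
by rewrite (conv_linear IP cp) ?fE ?gE; [ring|exact: cP..].
Qed.

Lemma eigen0 : eigen (fun=> 0).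
Proof.
split; first exact: cts_const.
have P0 : P (fun=> 0) = fun=> 0.
  apply/funext => x; rewrite /conv (_ : (fun y => _) = fun=> 0) ?(mean_cst IP)//.
  by apply/funext => y; rewrite mulr0.
by move=> x; rewrite !P0 mulr0.
Qed.

Lemma eigen_sum k (a : nat -> R) (f : nat -> X -> R) : (forall i, eigen (f i)) ->
  eigen (fun x => \sum_(i < k) a i * f i x).
Proof.
move=> ef; elim: k => [|k ih].
  by under eq_fun do rewrite big_ord0; exact: eigen0.
under eq_fun do rewrite big_ord_recr /=.
under eq_fun do rewrite -[X in X + _]mul1r.
exact: eigen_comb.
Qed.

Lemma eigen_shift f y : eigen f -> eigen (fun x => f (x + y)).
Proof.
move=> [cf fE]; have cy : continuous (fun x : X => x + y) by cts.
split; first exact: cts_comp cy cf.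
move=> x; have -> : P (fun x => f (x + y)) = fun x => P f (x + y).
  by apply/funext => z; rewrite (conv_shift IP cp).
by rewrite (conv_shift IP cp) ?fE//; exact: cP.
Qed.

(** Constants are orthogonal to the other eigenspaces. *)
Lemma eigen_mean0 f : I p = 0 -> eigen f -> I f = 0.
Proof.
move=> Ip [cf fE].
have c1 : continuous ((fun=> 1) : X -> R) by exact: cts_const.
have P1 : P (fun=> 1) = fun=> 0.
  apply/funext => x; rewrite -Ip -(mean_shift IP (- x) cp) /conv.
  by congr I; apply/funext => y; rewrite mulr1 -p_even opprB.
have : ip I (P (P f)) (fun=> 1) = 0.
  rewrite (conv_selfadjoint X_compact IP X_hausdorff cp p_even (cP cf) c1) P1 /ip.
  by rewrite (_ : (fun x => _) = fun=> 0) ?(mean_cst IP)//; apply/funext => x; rewrite mulr0.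
rewrite /ip (_ : (fun x => _) = fun x => lam * f x); last first.
  by apply/funext => x; rewrite fE mulr1.
by rewrite (meanZ IP)// => /eqP; rewrite mulf_eq0 gt_eqF//= => /eqP.
Qed.

(** Bessel's inequality for the translated kernel, whose coefficients on [f i] are
    the values of [lam * f i], bounds a sum of squares pointwise; integrating it
    counts the functions. *)
Lemma eigen_dim_bound k f : (forall i, eigen (f i)) -> orthonormal k f ->
  lam ^+ 2 * k%:R <= ip I p p ^+ 2.
Proof.
move=> ef of_; have cf i : continuous (f i) by have [] := ef i.
pose C := ip I p p.
have main x : \sum_(i < k) (lam * f i x) ^+ 2 <= C ^+ 2.
  pose px y := p (x - y).
  have cpx : continuous px by apply: (@cts_comp _ _ _ (fun z : X => x - z) _ _ cp); cts.
  have ipx : ip I px px = C.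
    rewrite /C /ip -[RHS](mean_shift IP (- x)); last by cts.
    by congr I; apply/funext => y; rewrite /px -p_even opprB.
  have fE i : ip I (P px) (f i) = lam * f i x.
    by have [_ <-] := ef i; rewrite (conv_selfadjoint X_compact IP X_hausdorff cp p_even).
  under eq_bigr do rewrite -fE.
  apply: le_trans (bessel cf (cP cpx) of_) _.
  apply: (ip_le IP (cP cpx)) => y.
  have C0 : 0 <= C by exact: (ip_ge0 IP).
  rewrite -ler_sqr ?nnegrE// real_normK ?num_real//.
  have := conv_sup X_compact IP cp p_even y cpx.
  by rewrite ipx -/C -expr2.
have -> : lam ^+ 2 * k%:R = I (fun x => \sum_(i < k) (lam * f i x) ^+ 2).
  rewrite (mean_sum IP); last first.
    by move=> i; cts.
  rewrite (eq_bigr (fun=> lam ^+ 2)); first by rewrite sumr_const card_ord mulr_natr.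
  move=> i _; transitivity (lam ^+ 2 * ip I (f i) (f i)).
    rewrite -(meanZ IP); last by cts.
    by congr I; apply/funext => x; ring.
  by rewrite of_// eqxx mulr1.
rewrite -[leRHS](mean_cst IP); apply: (mean_le IP) => //; last exact: cts_const.
by apply: cts_sum => i; cts.
Qed.

(** An orthonormal family of maximal size exists because sizes are bounded. A
    vector orthogonal to it would extend it, after normalization. *)
Lemma eigen_basis : (exists2 g, eigen g & exists x, g x != 0) ->
  exists k f, [/\ (0 < k)%N, forall i, eigen (f i), orthonormal k f &
    forall g, eigen g ->
      forall x, g x = \sum_(i < k) ip I g (f i) * f i x].
Proof.
move=> [g0 eg0 [x0 gx0]].
pose Q k := exists2 f, (forall i, eigen (f i)) & orthonormal k f.
have ext k f w a : (forall i, eigen (f i)) -> orthonormal k f -> eigen w ->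
    w a != 0 -> (forall i, (i < k)%N -> ip I w (f i) = 0) -> Q k.+1.
  move=> ef of_ ew wa w0; have cw : continuous w by have [] := ew.
  have cf i : continuous (f i) by have [] := ef i.
  have ww : 0 < ip I w w by exact: (ip_gt0 X_compact IP cw wa).
  pose c := (Num.sqrt (ip I w w))^-1.
  have cE : c ^+ 2 = (ip I w w)^-1 by rewrite exprVn sqr_sqrtr// ltW.
  pose w' x := c * w x.
  have ew' : eigen w'.
    have := eigen_comb c 0 ew eigen0; rewrite (_ : (fun x => _) = w')//.
    by apply/funext => x; rewrite mulr0 addr0.
  have w'f i : (i < k)%N -> ip I w' (f i) = 0.
    move=> ik; transitivity (c * ip I w (f i)); last by rewrite w0 ?mulr0.
    rewrite -(meanZ IP); last by cts.
    by congr I; apply/funext => x; rewrite /w' mulrA.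
  exists (fun i => if (i < k)%N then f i else w').
    by move=> i; case: ifP.
  have lek i : (i < k.+1)%N -> (i < k)%N = false -> i = k by lia.
  move=> i j ik jk; case: ifPn => [ik'|/negbTE /(lek _ ik) ->];
    case: ifPn => [jk'|/negbTE /(lek _ jk) ->].
  - exact: of_.
  - by rewrite ipC w'f// ltn_eqF.
  - by rewrite w'f// gtn_eqF.
  - by rewrite eqxx (ip_scale IP)// cE mulVf// gt_eqF.
have [|n Qn|k [f ef of_] nQ] := @bounded_maximum Q (Num.bound (ip I p p ^+ 2 / lam ^+ 2)).
- by exists (fun _ _ => 0) => // _; exact: eigen0.
- have [f ef of_] := Qn; have l2 : 0 < lam ^+ 2 by rewrite exprn_gt0.
  rewrite -(@ler_nat R) ltW// (le_lt_trans _ (archi_boundP _))//.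
    by rewrite ler_pdivlMr// mulrC; exact: eigen_dim_bound of_.
  by rewrite divr_ge0 ?sqr_ge0.
have cf i : continuous (f i) by have [] := ef i.
exists k, f; split => //.
  rewrite lt0n; apply/eqP => k0; apply: nQ; rewrite k0.
  by apply: (ext 0%N f g0 x0) => //; move=> ? ?.
move=> g eg x; have cg : continuous g by have [] := eg.
apply/eqP; rewrite -subr_eq0; apply/negPn/negP => nz; apply: nQ.
pose a i := ip I g (f i).
have ew := eigen_comb 1 (-1) eg (eigen_sum k a ef).
apply: (ext _ _ _ x ef of_ ew); first by rewrite mul1r mulN1r.
move=> i ik; rewrite (ip_linear IP)// ?ip_orthonormal_sum//.
  by rewrite mul1r mulN1r subrr.
by have [] := eigen_sum k a ef.
Qed.
End eigenspace.

(** * Existence of a nontrivial character *)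

(** The matrices span a finite-dimensional space, so finitely many of them have
    the same common eigenvectors as the whole family. *)
Lemma common_eigenvector_family (C : numClosedFieldType) (T : eqType) (n : nat)
    (A : T -> 'M[C]_n) : (0 < n)%N ->
  (forall s t, A s *m A t = A t *m A s) ->
  exists2 v : 'rV[C]_n, v != 0 & forall t, exists c, v *m A t = c *: v.
Proof.
move=> n0 AC; pose W (s : seq T) := (\sum_(t <- s) <<mxvec (A t)>>)%MS.
pose Q k := exists s, (k <= \rank (W s))%N.
have [|k [s sk]|k [s ks] nQ] := @bounded_maximum Q (n * n)%N.
- by exists [::].
- exact: leq_trans sk (rank_leq_row _).
have [v v0 /allP vs] : exists2 v : 'rV[C]_n, v != 0 &
    all (fun B : 'M[C]_n => stablemx v B) (map A s).
  apply: common_eigenvector => // _ _ /mapP[t _ ->] /mapP[u _ ->]; exact: AC.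
exists v => // t; apply/sub_rVP.
pose K := kermx (lin_mul_row v *m cokermx v).
have inK B : (mxvec B <= K)%MS = stablemx v B.
  by rewrite /K sub_kermx mulmxA mul_vec_lin_row submxE.
rewrite -inK; apply: submx_trans (_ : (mxvec (A t) <= W s)%MS) _.
  have sub : (W s <= W (t :: s))%MS by rewrite /W big_cons addsmxSr.
  have : (\rank (W (t :: s)) <= k)%N.
    by rewrite leqNgt; apply/negP => lt; apply: nQ; exists (t :: s).
  move=> /leq_trans /(_ ks) rk; have [_] := mxrank_leqif_sup sub.
  rewrite eqn_leq (mxrankS sub) rk /= => /esym sup.
  by apply: submx_trans sup; rewrite /W big_cons (submx_trans _ (addsmxSl _ _))// genmxE.
rewrite /W; elim: s vs {ks nQ} => [|u s ih] vs; first by rewrite big_nil sub0mx.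
rewrite big_cons addsmx_sub genmxE inK vs ?inE ?eqxx//= ih// => B Bs.
by apply: vs; rewrite inE Bs orbT.
Qed.
Lemma Re_sum (R : realType) n (F : 'I_n -> R[i]) :
  complex.Re (\sum_i F i) = \sum_i complex.Re (F i).
Proof. by elim/big_rec2: _ => // i _ y _ <-; case: y; case: (F i). Qed.

Lemma Im_sum (R : realType) n (F : 'I_n -> R[i]) :
  complex.Im (\sum_i F i) = \sum_i complex.Im (F i).
Proof. by elim/big_rec2: _ => // i _ y _ <-; case: y; case: (F i). Qed.

Section character.
Context (X : topologicalZmodType) (R : realType).
Hypothesis X_compact : compact [set: X].
Hypothesis X_hausdorff : hausdorff_space X.
Variable I : (X -> R) -> R.
Hypothesis IP : invariant_mean I.

(** The even part of a bump at [0] that vanishes at both [a] and [- a] still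
    separates [0] from [a], so that subtracting its mean leaves a nonzero function. *)
Lemma exists_even_mean0 (a : X) : a != 0 -> exists p : X -> R,
  [/\ continuous p, forall x, p (- x) = p x, exists x, p x != 0 & I p = 0].
Proof.
move=> a0; have nbh b : b != 0 -> nbhs (0 : X) (~` [set b]).
  move=> b0; apply: open_nbhs_nbhs; split; last by move=> /= /esym /eqP; apply/negP.
  apply: closed_openC; apply: accessible_closed_set1; exact: hausdorff_accessible.
have na0 : - a != 0 by rewrite oppr_eq0.
have [k [ck k0 k01 kU]] := exists_bump R X_compact X_hausdorff (filterI (nbh _ a0) (nbh _ na0)).
pose q x := k x + k (- x).
have cq : continuous q by rewrite /q; cts; apply: (@cts_comp _ _ _ -%R k _ ck); cts.
have qa : q a = 0.
  rewrite /q (kU a); last by case=> /= + _; apply.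
  by rewrite (kU (- a)) ?addr0//; case=> /= _; apply.
have q0 : q 0 = 2 by rewrite /q oppr0 k01.
exists (fun x => q x - I q); split.
- by apply: cts_sub => //; exact: cts_const.
- by move=> x; rewrite /q opprK [k (- x) + _]addrC.
- apply: contrapT => h; have h0 x : q x = I q.
    by apply/eqP; rewrite -subr_eq0; apply/negPn/negP => qx; apply: h; exists x.
  by have := h0 0; rewrite -(h0 a) qa q0 => /eqP; rewrite pnatr_eq0.
- by rewrite (meanB IP)// ?(mean_cst IP) ?subrr//; exact: cts_const.
Qed.

(** The powers of a value greater than [1] are unbounded, by Bernoulli's
    inequality. *)
Lemma bounded_multiplicative_eq1 (m : X -> R) (M : R) : (forall x, 0 <= m x <= M) ->
  m 0 = 1 -> (forall x y, m (x + y) = m x * m y) -> forall x, m x = 1.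
Proof.
move=> mM m0 mD.
have mn x n : m (x *+ n) = m x ^+ n.
  by elim: n => [|n ih]; rewrite ?mulr0n ?m0// mulrS mD ih exprS.
have le1 x : m x <= 1.
  rewrite leNgt; apply/negP => m1; pose h := m x - 1.
  have h0 : 0 < h by rewrite subr_gt0.
  have M0 : 0 <= M by have /andP[? ?] := mM x; exact: le_trans (_ : m x <= M).
  pose n := Num.bound (M / h).
  have : M < n%:R * h by rewrite -ltr_pdivrMr// archi_boundP// divr_ge0// ltW.
  rewrite ltNge => /negP; apply; have /andP[_] := mM (x *+ n); rewrite mn => Mn.
  apply: le_trans Mn; suff : 1 + n%:R * h <= m x ^+ n by lra.
  have -> : m x = 1 + h by rewrite /h; ring.
  elim: n => [|n ih]; first by rewrite mul0r addr0.
  rewrite exprS -natr1; apply: (@le_trans _ _ ((1 + h) * (1 + n%:R * h))).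
    have : 0 <= n%:R * (h * h) by rewrite !mulr_ge0// ltW.
    by lra.
  by apply: ler_wpM2l => //; rewrite addr_ge0// ltW.
move=> x; apply/eqP; rewrite eq_le le1 /=.
have := mD x (- x); rewrite subrr m0 => m1.
have /andP[mx0 _] := mM x; have /andP[mx1 _] := mM (- x).
by have := le1 (- x); nra.
Qed.

(** Translations act on a finite-dimensional eigenspace by commuting matrices
    [A y], which have a common complex eigenvector [v]; its eigenvalue [chi y] is
    a continuous character, with real part [c] and imaginary part [s]. If it were
    trivial, [v] would define a translation-invariant function in the eigenspace,
    that is a constant function of mean zero. *)
Lemma exists_character (a : X) : a != 0 -> exists c s : X -> R,
  [/\ continuous c, continuous s, exists x, c x != 1 &
    forall x, c x ^+ 2 + s x ^+ 2 = 1] /\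
  forall x y, c (x + y) = c x * c y - s x * s y /\
              s (x + y) = c x * s y + s x * c y.
Proof.
move=> /exists_even_mean0[p [cp p_even p_neq0 Ip]].
have [lam lam0 [g [cg g0 gE]]] :=
  exists_eigenfunction X_compact X_hausdorff IP cp p_even p_neq0.
have [k [f [k0 ef of_ fE]]] := eigen_basis X_compact X_hausdorff IP cp p_even lam0
  (ex_intro2 _ _ g (conj cg gE) g0).
have cf i : continuous (f i) by have [] := ef i.
pose A y : 'M[R]_k := \matrix_(i, j) ip I (fun x => f i (x + y)) (f j).
have cfs i y : continuous (fun x => f i (x + y)).
  by apply: (@cts_comp _ _ _ (fun x : X => x + y)); cts.
have fA (i : 'I_k) y x : f i (x + y) = \sum_(j < k) A y i j * f j x.
  rewrite (fE _ (eigen_shift X_compact IP cp y (ef i))).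
  by apply: eq_bigr => j _; rewrite mxE.
have AM y z : A (y + z) = A y *m A z.
  apply/matrixP => i j; rewrite !mxE.
  transitivity (ip I (fun x => \sum_(l < k) A y i l * f l (x + z)) (f j)).
    by congr ip; apply/funext => x; rewrite [y + z]addrC addrA fA.
  rewrite /ip (_ : (fun x => _) =
    fun x => \sum_(l < k) A y i l * (f l (x + z) * f j x)); last first.
    by apply/funext => x; rewrite mulr_suml; apply: eq_bigr => l _; rewrite mulrA.
  rewrite (mean_sum IP); last by move=> l; cts.
  by apply: eq_bigr => l _; rewrite (meanZ IP) ?[A z _ _]mxE//; cts.
have A0 : A 0 = 1%:M.
  apply/matrixP => i j; rewrite !mxE -[RHS]/((i == j :> nat)%:R) -of_//.
  by congr ip; apply/funext => x; rewrite addr0.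
have cA i j : continuous (fun y => A y i j).
  rewrite (_ : (fun y => _) = fun y => I (fun x => f i (x + y) * f j x)); last first.
    by apply/funext => y; rewrite mxE.
  apply: (@cts_mean _ _ X_compact _ IP (fun y x => f i (x + y) * f j x)).
  apply: cts_mul; last exact: (cts_comp (@cts_snd X X) (cf j)).
  by apply: (@cts_comp _ _ _ (fun z : X * X => z.2 + z.1)) => //; cts.
pose Ac y := map_mx (real_complex R) (A y).
have AcM y z : Ac (y + z) = Ac y *m Ac z by rewrite /Ac AM map_mxM.
have [|v v0 /choice[chi chiP]] := @common_eigenvector_family R[i] X k Ac k0.
  by move=> y z; rewrite -!AcM addrC.
have chiM y z : chi (y + z) = chi y * chi z.
  have : chi (y + z) *: v = (chi y * chi z) *: v.
    by rewrite -chiP AcM mulmxA chiP -scalemxAl chiP scalerA mulrC.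
  move/eqP; rewrite -subr_eq0 -scalerBl scaler_eq0 (negPf v0) orbF subr_eq0.
  by move/eqP.
have chi0 : chi 0 = 1.
  have : chi 0 *: v = 1 *: v by rewrite -chiP /Ac A0 map_mx1 mulmx1 scale1r.
  move/eqP; rewrite -subr_eq0 -scalerBl scaler_eq0 (negPf v0) orbF subr_eq0.
  by move/eqP.
have [j vj] : exists j, v 0 j != 0.
  by apply/rV0Pn.
have chiE y : chi y = \sum_i (v 0 i / v 0 j) * (A y i j)%:C%C.
  have /matrixP /(_ 0 j) := chiP y; rewrite !mxE => vA.
  apply: (mulIf vj); rewrite -vA mulr_suml; apply: eq_bigr => i _; rewrite mxE.
  by rewrite mulrAC divfK// mulrC.
have cRe : continuous (fun y => complex.Re (chi y)).
  rewrite (_ : (fun y => _) = fun y => \sum_i complex.Re (v 0 i / v 0 j) * A y i j).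
    by apply: cts_sum => i; cts.
  apply/funext => y; rewrite chiE Re_sum.
  by apply: eq_bigr => i _; case: (v 0 i / v 0 j) => ? ? /=; rewrite mulr0 subr0.
have cIm : continuous (fun y => complex.Im (chi y)).
  rewrite (_ : (fun y => _) = fun y => \sum_i complex.Im (v 0 i / v 0 j) * A y i j).
    by apply: cts_sum => i; cts.
  apply/funext => y; rewrite chiE Im_sum.
  by apply: eq_bigr => i _; case: (v 0 i / v 0 j) => ? ? /=; rewrite mulr0 add0r.
have mulE y z : complex.Re (chi (y + z)) = complex.Re (chi y) * complex.Re (chi z) - complex.Im (chi y) * complex.Im (chi z) /\
    complex.Im (chi (y + z)) = complex.Re (chi y) * complex.Im (chi z) + complex.Im (chi y) * complex.Re (chi z).
  by rewrite chiM; case: (chi y) => ? ?; case: (chi z).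
have [M1 M10 M1P] := continuous_bounded X_compact cRe.
have [M2 M20 M2P] := continuous_bounded X_compact cIm.
have mod1 : forall y, complex.Re (chi y) ^+ 2 + complex.Im (chi y) ^+ 2 = 1.
  apply: (@bounded_multiplicative_eq1 _ (M1 ^+ 2 + M2 ^+ 2)).
  - move=> y; rewrite addr_ge0 ?sqr_ge0//= lerD//.
      by rewrite -[leLHS]real_normK ?num_real// lerXn2r ?nnegrE.
    by rewrite -[leLHS]real_normK ?num_real// lerXn2r ?nnegrE.
  - by rewrite chi0 /= expr1n expr0n addr0.
  - by move=> y z; have [-> ->] := mulE y z; ring.
exists (fun y => complex.Re (chi y)), (fun y => complex.Im (chi y)); split => //; split => //.
- apply: contrapT => triv; have Re1 y : complex.Re (chi y) = 1.
    by apply/eqP/negPn/negP => h; apply: triv; exists y.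
  have Im0 y : complex.Im (chi y) = 0.
    by apply/eqP; rewrite -sqrf_eq0; apply/eqP; have := mod1 y; rewrite Re1; lra.
  have chi1 y : chi y = 1 by rewrite [chi y]complexE Re1 Im0 mulr0 addr0.
  have vA y l : \sum_i v 0 i * (A y i l)%:C%C = v 0 l.
    have /matrixP /(_ 0 l) := chiP y; rewrite chi1 scale1r !mxE => vA.
    by rewrite -[RHS]vA; apply: eq_bigr => i _; rewrite !mxE.
  (* applied to the real and to the imaginary part of [v] *)
  have key (b : 'I_k -> R) : (forall y l, \sum_i b i * A y i l = b l) -> forall l, b l = 0.
    move=> bA; pose b' (i : nat) := if insub i is Some i' then b i' else 0.
    have b'E (i : 'I_k) : b' i = b i by rewrite /b' valK.
    pose u x := \sum_(i < k) b' i * f i x.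
    have cu : continuous u by apply: cts_sum => i; cts.
    have ushift x y : u (x + y) = u x.
      rewrite /u; under eq_bigr do rewrite fA mulr_sumr.
      rewrite exchange_big /=; apply: eq_bigr => l _.
      rewrite b'E -(bA y l) mulr_suml; apply: eq_bigr => i _.
      by rewrite b'E mulrA.
    have Iu : I u = 0.
      rewrite (mean_sum IP); last by move=> i; cts.
      apply: big1 => i _; rewrite (meanZ IP)//.
      by rewrite (eigen_mean0 X_compact X_hausdorff IP cp p_even lam0)// mulr0.
    have u0 x : u x = 0.
      rewrite -Iu (_ : u = fun=> u x) ?(mean_cst IP)//.
      by apply/funext => z; rewrite -(ushift x (z - x)) addrC subrK.
    move=> l; rewrite -b'E -(ip_orthonormal_sum IP b' cf of_ (ltn_ord l)).
    rewrite /ip (_ : (fun x => _) = fun=> 0) ?(mean_cst IP)//.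
    by apply/funext => x; rewrite -/(u x) u0 mul0r.
  have vRe : forall l, complex.Re (v 0 l) = 0.
    apply: key => y l; rewrite -[in RHS](vA y) Re_sum; apply: eq_bigr => i _.
    by case: (v 0 i) => ? ? /=; rewrite mulr0 subr0.
  have vIm : forall l, complex.Im (v 0 l) = 0.
    apply: key => y l; rewrite -[in RHS](vA y) Im_sum; apply: eq_bigr => i _.
    by case: (v 0 i) => ? ? /=; rewrite mulr0 add0r.
  by move: vj; rewrite [v 0 j]complexE vRe vIm mulr0 addr0 eqxx.
Qed.
End character.

(** * Angles measured in turns *)

Section turns.
Context (R : realType).
Implicit Types t u : R.

(** One turn is the angle 2 pi, so that integers are the trivial angles. *)
Definition cos_turn t : R := cos (t * (pi *+ 2)).
Definition sin_turn t : R := sin (t * (pi *+ 2)).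

Lemma cos_turnD t u : cos_turn (t + u) = cos_turn t * cos_turn u - sin_turn t * sin_turn u.
Proof. by rewrite /cos_turn mulrDl cosD. Qed.

Lemma sin_turnD t u : sin_turn (t + u) = sin_turn t * cos_turn u + cos_turn t * sin_turn u.
Proof. by rewrite /sin_turn mulrDl sinD. Qed.

Lemma cos_turnN t : cos_turn (- t) = cos_turn t.
Proof. by rewrite /cos_turn mulNr cosN. Qed.

Lemma sin_turnN t : sin_turn (- t) = - sin_turn t.
Proof. by rewrite /sin_turn mulNr sinN. Qed.

Lemma cos_turn_sin_turn t : cos_turn t ^+ 2 + sin_turn t ^+ 2 = 1.
Proof. exact: cos2Dsin2. Qed.

Lemma int_num_eq t u : t = u -> t \is a Num.int -> u \is a Num.int.
Proof. by move=> ->. Qed.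

Lemma int_num_lt1 t : t \is a Num.int -> `|t| < 1 -> t = 0.
Proof.
move=> /intrP[m ->]; rewrite -intr_norm (_ : 1 = 1%:~R)// ltr_int => m1.
by have -> : m = 0 by lia.
Qed.

Lemma turn_pi t : t * (pi *+ 2) = (2 * t) * pi.
Proof. by rewrite -mulr_natr; ring. Qed.

Lemma pi2_ge0 : 0 <= (pi : R) *+ 2.
Proof. by apply: mulrn_wge0; rewrite ltW// pi_gt0. Qed.

Lemma cos_turn_lt (e t : R) : 0 <= e < `|t| -> `|t| <= 1 / 2 -> cos_turn t < cos_turn e.
Proof.
move=> /andP[e0 et] t2; have p0 := @pi_gt0 R.
have in0pi (r : R) : 0 <= r <= 1 / 2 -> r * (pi *+ 2) \in `[0, (pi : R)].
  move=> /andP[r0 r2]; rewrite turn_pi in_itv/=; apply/andP; split.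
    by rewrite !mulr_ge0// ltW.
  by rewrite -[leRHS]mul1r ler_pM2r//; lra.
rewrite /cos_turn -cos_norm normrM (ger0_norm pi2_ge0).
rewrite ltr_cos.
- by rewrite ltr_pM2r// mulrn_wgt0.
- by apply: in0pi; rewrite e0 (le_trans (ltW et)).
- by apply: in0pi; rewrite normr_ge0.
Qed.

Lemma cos_turn_0 : cos_turn 0 = 1. Proof. by rewrite /cos_turn mul0r cos0. Qed.
Lemma sin_turn_0 : sin_turn 0 = 0. Proof. by rewrite /sin_turn mul0r sin0. Qed.

Lemma cos_turn_nat n : cos_turn n%:R = 1 /\ sin_turn n%:R = 0.
Proof.
elim: n => [|n [ihc ihs]]; first by rewrite cos_turn_0 sin_turn_0.
rewrite -natr1 cos_turnD sin_turnD ihc ihs /cos_turn /sin_turn !mul1r cos2pi sin2pi.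
by split; ring.
Qed.

Lemma cos_turn_int t : t \is a Num.int -> cos_turn t = 1 /\ sin_turn t = 0.
Proof.
move=> /intrP[m ->]; case: (intP m) => [|n|n]; first by rewrite cos_turn_0 sin_turn_0.
  exact: cos_turn_nat.
by rewrite mulrNz cos_turnN sin_turnN; have [-> ->] := cos_turn_nat n.+1; rewrite oppr0.
Qed.

Lemma cos_turn_eq1 t : cos_turn t = 1 -> t \is a Num.int.
Proof.
move=> ct; pose m : R := (Num.floor (t + 1 / 2))%:~R.
have mi : m \is a Num.int by exact: intr_int.
have tm : `|t - m| <= 1 / 2.
  have /andP[] := floor_itv (t + 1 / 2); rewrite intrD -/m => ? ?.
  by rewrite ler_norml; apply/andP; split; lra.
have [cm sm] := cos_turn_int mi.
have c1 : cos_turn (t - m) = 1 by rewrite cos_turnD cos_turnN sin_turnN cm sm ct; ring.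
have [/eqP|tm0] := eqVneq (t - m) 0; first by rewrite subr_eq0 => /eqP ->.
have := @cos_turn_lt 0 (t - m); rewrite lexx normr_gt0 tm0 => /(_ isT tm).
by rewrite c1 cos_turn_0 ltxx.
Qed.

Lemma cos_turn_sin_turn_inj t u : cos_turn t = cos_turn u -> sin_turn t = sin_turn u ->
  t - u \is a Num.int.
Proof.
move=> c s; apply: cos_turn_eq1; rewrite cos_turnD cos_turnN sin_turnN c s -[RHS](cos_turn_sin_turn u).
by ring.
Qed.

Lemma turn_exists (a b : R) : a ^+ 2 + b ^+ 2 = 1 ->
  exists t, [/\ `|t| <= 1 / 2, cos_turn t = a & sin_turn t = b].
Proof.
move=> ab; have a1 : -1 <= a <= 1.
  by have := sqr_ge0 b; have := sqr_ge0 a => *; apply/andP; split; nra.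
have p0 := @pi_gt0 R.
pose u := acos a / (pi *+ 2).
have uE : u * (pi *+ 2) = acos a by rewrite /u divfK// gt_eqF// mulrn_wgt0.
have u0 : 0 <= u by rewrite divr_ge0 ?pi2_ge0 ?acos_ge0.
have u2 : u <= 1 / 2.
  rewrite ler_pdivrMr; last by rewrite mulrn_wgt0.
  by rewrite turn_pi; have := acos_lepi a1; lra.
have cu : cos_turn u = a by rewrite /cos_turn uE acosK// in_itv.
have su : sin_turn u = `|b|.
  by rewrite /sin_turn uE sin_acos// -sqrtr_sqr; congr Num.sqrt; lra.
have [b0|b0] := leP 0 b.
  by exists u; rewrite ger0_norm// cu su ger0_norm.
exists (- u); rewrite normrN ger0_norm// cos_turnN sin_turnN cu su ltr0_norm//.
by rewrite opprK.
Qed.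

End turns.

(** A continuous character of [X] given by its argument in turns, normalized to
    be at most a half turn. Sums of angles are only meaningful modulo integers,
    but small angles can be computed with as real numbers. *)
Record angle (X : topologicalZmodType) (R : realType) (theta : X -> R) : Prop :=
  Angle {
  angleD : forall x y, theta (x + y) - (theta x + theta y) \is a Num.int;
  angle_half : forall x, `|theta x| <= 1 / 2;
  angle_cos : continuous (fun x => cos_turn (theta x));
  angle_sin : continuous (fun x => sin_turn (theta x)) }.

Section angle.
Context (X : topologicalZmodType) (R : realType) (theta : X -> R).
Hypothesis thetaP : angle theta.

Lemma angle0 : theta 0 = 0.
Proof.
have := angleD thetaP 0 0; rewrite addr0 opprD addrA subrr sub0r rpredN.
by move=> /int_num_lt1; apply; have := angle_half thetaP 0; lra.
Qed.

Lemma angle_sum (K : Type) (r : seq K) (x : K -> X) :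
  theta (\sum_(k <- r) x k) - \sum_(k <- r) theta (x k) \is a Num.int.
Proof.
elim: r => [|k r ih]; first by rewrite !big_nil angle0 subrr rpred0.
rewrite !big_cons; set s := \sum_(j <- r) x j in ih *.
set S := \sum_(j <- r) theta (x j) in ih *.
have -> : theta (x k + s) - (theta (x k) + S) =
  (theta (x k + s) - (theta (x k) + theta s)) + (theta s - S) by ring.
by rewrite rpredD// angleD.
Qed.

Lemma angleN x : theta (- x) + theta x \is a Num.int.
Proof.
have := angleD thetaP (- x) x; rewrite addNr angle0 sub0r rpredN.
by [].
Qed.

Lemma angleMn x n : theta (x *+ n) - theta x *+ n \is a Num.int.
Proof.
elim: n => [|n ih]; first by rewrite !mulr0n angle0 subrr rpred0.
rewrite !mulrS.
have -> : theta (x + x *+ n) - (theta x + theta x *+ n) =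
  (theta (x + x *+ n) - (theta x + theta (x *+ n))) + (theta (x *+ n) - theta x *+ n).
  by set u := theta x *+ n; ring.
by rewrite rpredD// angleD.
Qed.

Lemma angleMz x (m : int) : theta (x *~ m) - m%:~R * theta x \is a Num.int.
Proof.
case: m => n; first by rewrite -pmulrn mulr_natl; exact: angleMn.
rewrite NegzE mulrNz mulNr opprK.
rewrite -pmulrn mulr_natl.
have -> : theta (- (x *+ n.+1)) + theta x *+ n.+1 =
  (theta (- (x *+ n.+1)) + theta (x *+ n.+1)) - (theta (x *+ n.+1) - theta x *+ n.+1).
  by set u := theta x *+ n.+1; ring.
by rewrite rpredB ?angleN ?angleMn.
Qed.

(** The cosine is strictly decreasing on half a turn. *)
Lemma angle_small (e : R) : 0 < e -> \forall x \near (0 : X), `|theta x| < e.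
Proof.
move=> e0; have [e2|e2] := ltP (1 / 2) e.
  by near=> x; exact: le_lt_trans (angle_half thetaP x) e2.
have ce : cos_turn e < 1.
  by rewrite -cos_turn_0 cos_turn_lt// ?lexx gtr0_norm.
have : nbhs (0 : X) [set x | cos_turn e < cos_turn (theta x)].
  apply: (angle_cos thetaP (x := 0) (t := [set r | cos_turn e < r])); apply: open_nbhs_nbhs; split; first exact: open_gt.
  by rewrite /= angle0 cos_turn_0.
apply: filterS => x /= cx; rewrite ltNge; apply/negP => ex.
move: cx; apply/negP; rewrite -leNgt.
move: ex; rewrite le_eqVlt => /predU1P[->|ex]; first by rewrite /cos_turn -[in leLHS]cos_norm normrM (ger0_norm (pi2_ge0 R)).
by rewrite ltW// cos_turn_lt ?(angle_half thetaP)// (ltW e0).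
Unshelve. all: by end_near. Qed.

End angle.

Lemma exists_angle (X : topologicalZmodType) (R : realType) (c s : X -> R) :
  continuous c -> continuous s -> (forall x, c x ^+ 2 + s x ^+ 2 = 1) ->
  (forall x y, c (x + y) = c x * c y - s x * s y /\
              s (x + y) = c x * s y + s x * c y) ->
  exists2 theta : X -> R, angle theta & forall x, cos_turn (theta x) = c x.
Proof.
move=> cc cs cs1 csD; have [theta tP] := choice (fun x => turn_exists (cs1 x)).
have tc : (fun x => cos_turn (theta x)) = c by apply/funext => x; have [] := tP x.
have ts : (fun x => sin_turn (theta x)) = s by apply/funext => x; have [] := tP x.
have tcx x : cos_turn (theta x) = c x by rewrite -tc.
have tsx x : sin_turn (theta x) = s x by rewrite -ts.
exists theta => //; split; rewrite ?tc ?ts//; last by move=> x; have [] := tP x.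
move=> x y; have [cD sD] := csD x y; apply: cos_turn_sin_turn_inj.
  by rewrite tcx cD cos_turnD !tcx !tsx.
by rewrite tsx sD sin_turnD !tcx !tsx addrC.
Qed.

(** * Polynomials in the shift acting on two-sided sequences *)

(** The action of the polynomial with coefficients [s], its variable acting as the
    shift [u |-> u (_ + 1)]. *)
Definition pact (K : pzRingType) (s : seq K) (u : int -> K) (n : int) : K :=
  \sum_(i < size s) s`_i * u (n + i%:Z).

Section polynomial_action.
Context (K : idomainType).
Implicit Types (p q : {poly K}) (u v : int -> K).

Lemma pactE m p u n : (size p <= m)%N -> pact p u n = \sum_(i < m) p`_i * u (n + i%:Z).
Proof.
move=> pm; rewrite /pact (big_ord_widen m (fun i => p`_i * u (n + i%:Z)))//.
rewrite [RHS](bigID (fun i : 'I_m => (i < size p)%N))/= [X in _ + X]big1 ?addr0//.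
by move=> i; rewrite -leqNgt => pi; rewrite nth_default ?mul0r.
Qed.

Lemma pactD p q u n : pact (p + q) u n = pact p u n + pact q u n.
Proof.
pose m := maxn (size p) (size q).
rewrite !(@pactE m) ?leq_maxl ?leq_maxr// ?(leq_trans (size_polyD _ _))//.
by rewrite -big_split; apply: eq_bigr => i _; rewrite coefD mulrDl.
Qed.

Lemma pactCM c q u n : pact (c%:P * q) u n = c * pact q u n.
Proof.
rewrite (@pactE (size q)); last first.
  have [->|c0] := eqVneq c 0; first by rewrite mul0r size_poly0.
  by rewrite size_Cmul.
by rewrite /pact mulr_sumr; apply: eq_bigr => i _; rewrite coefCM mulrA.
Qed.

Lemma pactMX q u n : pact (q * 'X) u n = pact q u (n + 1).
Proof.
rewrite (@pactE (size q).+1); last first.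
  have [->|q0] := eqVneq q 0; first by rewrite mul0r size_poly0.
  by rewrite size_mulX.
rewrite big_ord_recl coefMX mul0r add0r; apply: eq_bigr => i _.
rewrite coefMX /=; congr (_ * u _); rewrite /bump; lia.
Qed.

Lemma pactM p q u n : pact (p * q) u n = pact p (pact q u) n.
Proof.
elim/poly_ind: p n => [|p c ih] n.
  by rewrite mul0r /pact size_poly0 !big_ord0.
rewrite mulrDl pactD pactCM [LHS]addrC -mulrA ['X * q]mulrC mulrA pactMX ih.
rewrite pactD pactMX -[c%:P]mulr1 pactCM addrC; congr (_ + c * _).
by rewrite [RHS](@pactE 1) ?size_poly1// big_ord1 coef1 mul1r addr0.
Qed.

Lemma pactBr p u v n : pact p (fun i => u i - v i) n = pact p u n - pact p v n.
Proof. by rewrite -sumrB; apply: eq_bigr => i _; rewrite mulrBr. Qed.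

Lemma pactZr p c u n : pact p (fun i => c * u i) n = c * pact p u n.
Proof. by rewrite mulr_sumr; apply: eq_bigr => i _; rewrite mulrCA. Qed.

End polynomial_action.

Definition vanishes (K : numDomainType) (u : int -> K) : Prop :=
  forall e : K, 0 < e -> exists N : nat, forall n : int, (N <= `|n|)%N -> `|u n| < e.

Section vanishing.
Context (K : numFieldType).
Implicit Types (p : {poly K}) (u v : int -> K).

Lemma vanishes_pact p u : vanishes u -> vanishes (pact p u).
Proof.
move=> uv e e0; pose S := \sum_(i < size p) `|p`_i|.
have S0 : 0 <= S by exact: sumr_ge0.
have S1 : 0 < S + 1 by rewrite ltr_wpDl.
have [N hN] := uv (e / (S + 1)) (divr_gt0 e0 S1).
exists (N + size p)%N => n nN; apply: (@le_lt_trans _ _ (S * (e / (S + 1)))).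
  rewrite mulr_suml (le_trans (ler_norm_sum _ _ _))//; apply: ler_sum => i _.
  case: i => i ip; rewrite normrM ler_wpM2l// ltW// hN//=; have {}ip : (N + i <= `|n|)%N by apply: leq_trans nN; rewrite leq_add2l ltnW.
  by clear -ip; lia.
by rewrite mulrA ltr_pdivrMr// mulrC ltr_pM2l// ltrDl.
Qed.

Lemma vanishesB u v : vanishes u -> vanishes v -> vanishes (fun n => u n - v n).
Proof.
move=> uv vv e e0; have e2 : 0 < e / 2 by rewrite divr_gt0.
have [N hN] := uv _ e2; have [M hM] := vv _ e2.
exists (maxn N M) => n; rewrite geq_max => /andP[nN nM].
rewrite (le_lt_trans (ler_normB _ _))// [e]splitr ltrD ?hN ?hM//.
Qed.

Lemma vanishesZ c u : vanishes u -> vanishes (fun n => c * u n).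
Proof.
move=> uv e e0; have c1 : 0 < `|c| + 1 by rewrite ltr_wpDl.
have [N hN] := uv _ (divr_gt0 e0 c1); exists N => n nN; rewrite normrM.
apply: (@le_lt_trans _ _ (`|c| * (e / (`|c| + 1)))); first by rewrite ler_wpM2l// ltW// hN.
by rewrite mulrA ltr_pdivrMr// mulrC ltr_pM2l// ltrDl.
Qed.

Lemma vanishes_finite u (N : nat) : (forall n : int, (N <= `|n|)%N -> u n = 0) ->
  vanishes u.
Proof. by move=> u0 e e0; exists N => n nN; rewrite u0// normr0. Qed.

End vanishing.

Lemma vanishes_geometric (C : numClosedFieldType) (z : C) (v : int -> C) :
  vanishes v -> (forall n, v (n + 1) = z * v n) -> forall n, v n = 0.
Proof.
move=> vv vS m; apply/eqP/negPn/negP => vm.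
have vm0 : 0 < `|v m| by rewrite normr_gt0.
have [N hN] := vv _ vm0.
have := real_leP (normr_real z) (real1 C).
case=> z1.
  have grow k : `|v m| <= `|v (m - k%:Z)|.
    elim: k => [|k ih]; first by rewrite subr0.
    apply: le_trans ih _; have := vS (m - k.+1%:Z).
    have -> : m - k.+1%:Z + 1 = m - k%:Z by lia.
    by move=> ->; rewrite normrM ler_piMl.
  have hm : (N <= `|(m - (N + `|m|)%N%:Z)%R|)%N by clear; lia.
  by have := le_lt_trans (grow _) (hN _ hm); rewrite ltxx.
have grow k : `|v m| <= `|v (m + k%:Z)|.
  elim: k => [|k ih]; first by rewrite addr0.
  apply: le_trans ih _; have -> : m + k.+1%:Z = m + k%:Z + 1 by lia.
  by rewrite vS normrM ler_peMl// ltW.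
have hm : (N <= `|(m + (N + `|m|)%N%:Z)%R|)%N by clear; lia.
by have := le_lt_trans (grow _) (hN _ hm); rewrite ltxx.
Qed.

(** Over an algebraically closed field the recurrence factors into recurrences of
    order one, whose solutions are geometric; a nonzero geometric sequence does
    not tend to zero at both ends. *)
Lemma vanishing_recurrence (C : numClosedFieldType) (p : {poly C}) (u : int -> C) :
  p != 0 -> vanishes u -> (forall n, pact p u n = 0) -> forall n, u n = 0.
Proof.
move=> p0 uv pu; have [rs pE] := closed_field_poly_normal p.
have {pu} : forall n, pact (\prod_(z <- rs) ('X - z%:P)) u n = 0.
  move=> n; apply/eqP; have /eqP := pu n; rewrite {1}pE -mul_polyC pactCM mulf_eq0.
  by rewrite lead_coef_eq0 (negPf p0).
elim: rs {pE} => [|z rs ih] pu.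
  by move=> n; have := pu n; rewrite big_nil (@pactE _ 1) ?size_poly1// big_ord1 coef1 mul1r addr0.
apply: ih; apply: (@vanishes_geometric _ z); first exact: vanishes_pact.
move=> n; have := pu n; rewrite big_cons pactM.
rewrite (@pactE _ 2) ?size_XsubC// !big_ord_recl big_ord0 /= !coefB !coefX !coefC /=.
by rewrite addr0 subr0 sub0r mul1r addr0 addrC mulNr => /eqP; rewrite subr_eq0 => /eqP.
Qed.

(** * The pairing between vanishing and bounded sequences *)

Section pairing.
Context (R : realType).
Implicit Types (u v w : int -> R) (f : {poly R}).

(** A half-open window has an even number of terms, and [rev_ord] reflects it. *)
Definition window (N : nat) u : R := \sum_(k < N.*2) u (k%:Z - N%:Z).

Lemma window_shift N w (i : nat) :
  window N (fun j => w (j + i%:Z)) - window N w =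
  \sum_(l < i) (w (N%:Z + l%:Z) - w (l%:Z - N%:Z)).
Proof.
(* telescoping: shifting a window by one replaces one end by the other *)
have tele (v : nat -> R) M : \sum_(k < M) v k.+1 - \sum_(k < M) v k = v M - v 0%N.
  elim: M => [|M ih]; first by rewrite !big_ord0 !subrr.
  by rewrite !big_ord_recr /=; lra.
elim: i => [|i ih].
  rewrite big_ord0; apply/eqP; rewrite subr_eq0; apply/eqP; apply: eq_bigr => k _.
  by rewrite addr0.
rewrite big_ord_recr /= -ih.
have := tele (fun k => w (k%:Z - N%:Z + i%:Z)) N.*2.
have -> : (N.*2)%:Z - N%:Z + i%:Z = N%:Z + i%:Z by lia.
have -> : 0%N%:Z - N%:Z + i%:Z = i%:Z - N%:Z by lia.
have -> : \sum_(k < N.*2) w (k.+1%:Z - N%:Z + i%:Z) = window N (fun j => w (j + i.+1%:Z)).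
  by apply: eq_bigr => k _; congr w; lia.
by rewrite /window => h; lra.
Qed.

Lemma window_support N M u : (forall j : int, (N <= `|j|)%N -> u j = 0) ->
  (N <= M)%N -> window M u = window N u.
Proof.
move=> u0 NM; rewrite -(subnK NM) addnC; elim: (M - N)%N => [|k ih]; first by rewrite addn0.
rewrite -ih /window addnS doubleS big_ord_recr big_ord_recl /=.
rewrite [X in X + _ + _]u0 ?[X in _ + _ + X]u0 ?add0r ?addr0; [|lia..].
by apply: eq_bigr => i _; congr u; rewrite /bump; lia.
Qed.

(** Formally [(f u) * v = u * (f v) = 0] for the convolution of sequences, but
    [u] need not be summable. Truncation to a window replaces the formal identity
    by boundary terms, which involve boundedly many values of [u] near the two
    ends of the window, and so tend to zero. *)
Lemma pairing f u v (B : R) : vanishes u -> 0 <= B -> (forall n, `|v n| <= B) ->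
  (forall n, pact f v n = 0) ->
  forall m e, 0 < e -> exists N0, forall N, (N0 <= N)%N ->
    `|window N (fun j => pact f u j * v (m - j))| < e.
Proof.
move=> u0 B0 vB fv m e e0.
pose C := \sum_(i < size f) `|f`_i| * (\sum_(l < i) (B + B)).
have C0 : 0 <= C by apply: sumr_ge0 => i _; rewrite mulr_ge0// sumr_ge0// => l _; rewrite addr_ge0.
have C1 : 0 < C + 1 by rewrite ltr_wpDl.
pose d := e / (C + 1); have d0 : 0 < d by rewrite divr_gt0.
have [N1 hN1] := u0 d d0; exists (N1 + size f)%N => N hN.
pose w (i : nat) (j : int) := u j * v (m - j + i%:Z).
have -> : window N (fun j => pact f u j * v (m - j)) =
    \sum_(i < size f) f`_i * (\sum_(l < i) (w i (N%:Z + l%:Z) - w i (l%:Z - N%:Z))).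
  transitivity (\sum_(i < size f) f`_i *
      (window N (fun j => w i (j + i%:Z)) - window N (w i))); last first.
    by apply: eq_bigr => i _; rewrite window_shift.
  have zero : \sum_(i < size f) f`_i * window N (w i) = 0.
    under eq_bigr do rewrite mulr_sumr; rewrite exchange_big big1// => k _.
    transitivity (u (k%:Z - N%:Z) * pact f v (m - (k%:Z - N%:Z))); last by rewrite fv mulr0.
    by rewrite /pact mulr_sumr; apply: eq_bigr => i _; rewrite /w mulrCA.
  under eq_bigr do rewrite mulrBr; rewrite sumrB zero subr0.
  under [RHS]eq_bigr do rewrite mulr_sumr; rewrite exchange_big /=.
  apply: eq_bigr => k _; rewrite mulr_suml; apply: eq_bigr => i _.
  by rewrite /w mulrA; congr (_ * v _); lia.
apply: (@le_lt_trans _ _ (C * d)); last by rewrite mulrA ltr_pdivrMr// mulrC ltr_pM2l// ltrDl.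
rewrite (le_trans (ler_norm_sum _ _ _))// mulr_suml; apply: ler_sum => i _.
rewrite normrM -mulrA ler_wpM2l// (le_trans (ler_norm_sum _ _ _))// mulr_suml.
apply: ler_sum => l _; have li := ltn_ord l; have is_ := ltn_ord i.
have wd j : (N1 <= `|j|)%N -> `|w i j| <= B * d.
  by move=> jN; rewrite normrM mulrC ler_pM// ltW// hN1.
have hN' : (N1 + l <= N)%N.
  by apply: leq_trans hN; rewrite leq_add2l ltnW// (ltn_trans li).
by rewrite mulrDl (le_trans (ler_normB _ _))// lerD// wd//; clear -hN'; lia.
Qed.

(** Acting by this polynomial is, up to a shift, convolving with [g]. *)
Definition reflect_poly (g : int -> int) (N : nat) : {poly int} :=
  \poly_(j < N.*2) g (N%:Z - 1 - j%:Z).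

Lemma pact_reflect g N v n :
  pact (map_poly intr (reflect_poly g N)) v n =
  window N (fun j => (g j)%:~R * v (n + N%:Z - 1 - j)).
Proof.
rewrite (@pactE _ N.*2); last first.
  by rewrite (leq_trans (size_poly _ _))// size_poly.
rewrite /window (reindex_inj rev_ord_inj) /=; apply: eq_bigr => k _.
rewrite coef_map coef_poly /=; have kN := ltn_ord k.
rewrite ltn_subrL /= (leq_ltn_trans (leq0n k) kN).
by congr ((g _)%:~R * v _); lia.
Qed.

(** For an [f u] of finite support the pairing is eventually independent of the
    window, hence zero. *)
Lemma reflect_annihilates f u v (B : R) (g : int -> int) (N : nat) :
  vanishes u -> 0 <= B -> (forall n, `|v n| <= B) ->
  (forall n, pact f v n = 0) -> (forall n, pact f u n = (g n)%:~R) ->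
  (forall j : int, (N <= `|j|)%N -> g j = 0) ->
  forall n, pact (map_poly intr (reflect_poly g N)) v n = 0.
Proof.
move=> u0 B0 vB fv fu g0 n; rewrite pact_reflect.
apply/eqP/negPn/negP; rewrite -normr_gt0 => an0.
have [N0 /(_ _ (leq_maxr N N0))] := pairing u0 B0 vB fv (n + N%:Z - 1) an0.
rewrite (@window_support N) ?leq_maxl// => [|j jN]; last by rewrite fu g0 ?mul0r.
rewrite (_ : (fun j => _) = fun j => (g j)%:~R * v (n + N%:Z - 1 - j)) ?ltxx//.
by apply/funext => j; rewrite fu.
Qed.
End pairing.

(** * Iterates of an automorphism and homoclinic points *)

Lemma continuous_mulrz (X : topologicalZmodType) (m : int) :
  continuous (fun y : X => y *~ m).
Proof.
have cn k : continuous (fun y : X => y *+ k).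
  elim: k => [|k ih]; first by under eq_fun do rewrite mulr0n; exact: cts_const.
  by under eq_fun do rewrite mulrS; exact: cts_addX (@cts_id _) ih.
case: m => k; first exact: cn.
by apply: (@cts_oppX X X (fun y => y *+ k.+1)); exact: cn.
Qed.

Section automorphism.
Context (X : topologicalZmodType) (alpha : automorphism X).

Local Notation it := (aut_iter alpha).

Lemma aut_inj : injective alpha.
Proof. exact: can_inj (autK alpha). Qed.

Lemma aut_iterS n x : it (n + 1) x = alpha (it n x).
Proof.
case: n => [k|[|k]]; last 2 first.
- by rewrite /= aut_invK.
- have -> : Negz k.+1 + 1 = Negz k by lia.
  by rewrite /= aut_invK.
- by have -> : Posz k + 1 = Posz k.+1 by lia.
Qed.

Lemma aut_iterD m n x : it (m + n) x = it m (it n x).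
Proof.
elim/int_rec: m => [|m ih|m ih]; first by rewrite add0r.
  rewrite (_ : m.+1%:Z + n = m%:Z + n + 1); last by lia.
  by rewrite aut_iterS ih -aut_iterS; congr (it _ _); lia.
apply: aut_inj; rewrite -!aut_iterS.
rewrite (_ : - m.+1%:Z + n + 1 = - m%:Z + n); last by lia.
by rewrite ih; congr (it _ _); lia.
Qed.

Lemma aut_iterSr n x : it (n + 1) x = it n (alpha x).
Proof. by rewrite aut_iterD. Qed.

Lemma aut_iterB n x y : it n (x - y) = it n x - it n y.
Proof.
elim/int_rec: n => [//|m ih|m ih].
  by rewrite (_ : m.+1%:Z = m%:Z + 1) ?aut_iterS ?ih ?raddfB//; lia.
apply: aut_inj; rewrite raddfB -!aut_iterS (_ : - m.+1%:Z + 1 = - m%:Z)//; lia.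
Qed.

Lemma aut_iter0 n : it n 0 = 0.
Proof. by have := aut_iterB n 0 0; rewrite !subrr. Qed.

Lemma aut_iterN n x : it n (- x) = - it n x.
Proof. by have := aut_iterB n 0 x; rewrite !sub0r aut_iter0 sub0r. Qed.

Lemma aut_iter_add n x y : it n (x + y) = it n x + it n y.
Proof. by have := aut_iterB n x (- y); rewrite aut_iterN !opprK. Qed.

Lemma aut_iter_mulz n x (m : int) : it n (x *~ m) = it n x *~ m.
Proof.
have nat_case k : it n (x *+ k) = it n x *+ k.
  by elim: k => [|k ih]; rewrite ?mulr0n ?aut_iter0// !mulrS aut_iter_add ih.
case: m => k; rewrite ?NegzE ?mulrNz ?aut_iterN -!pmulrn nat_case//.
Qed.

Lemma aut_iter_inj n : injective (it n).
Proof.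
move=> x y xy; have : it (- n) (it n x) = it (- n) (it n y) by rewrite xy.
by rewrite -!aut_iterD addNr.
Qed.

Hypothesis X_compact : compact [set: X].
Hypothesis X_hausdorff : hausdorff_space X.

(** A continuous bijection from a compact space to a Hausdorff space is closed. *)
Lemma aut_inv_continuous : continuous (aut_inv alpha).
Proof.
apply/continuous_closedP => C cC.
have -> : aut_inv alpha @^-1` C = alpha @` C.
  apply/seteqP; split => x /=; last by move=> [y Cy <-]; rewrite autK.
  by move=> Cx; exists (aut_inv alpha x) => //; rewrite aut_invK.
apply: compact_closed => //; apply: continuous_compact.
  exact: continuous_subspaceT (@aut_continuous _ alpha).
exact: subclosed_compact cC X_compact _.
Qed.

Lemma aut_iter_continuous n : continuous (it n).
Proof.
have iterc (f : X -> X) k : continuous f -> continuous (iter k f).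
  move=> cf; elim: k => [|k ih]; first exact: cts_id.
  exact: cts_comp ih cf.
case: n => k; apply: iterc; first exact: aut_continuous.
exact: aut_inv_continuous.
Qed.

(** The largest invariant subset of [S]. *)
Definition invariant_core (S : set X) : set X := [set x | forall n, S (it n x)].

Lemma invariant_core_finite (S : set X) : irreducible alpha ->
  closed S -> is_subgroup S -> (exists x, ~ S x) -> finite_set (invariant_core S).
Proof.
move=> irr cS [S0 SB] [x nSx]; apply: irr.
- rewrite (_ : invariant_core S = \bigcap_n (it n @^-1` S)).
    apply: closed_bigI => n _; move/continuous_closedP: (@aut_iter_continuous n).
    exact.
  by apply/seteqP; split => y h n => [_|]; exact: h.
- split; first by move=> n; rewrite aut_iter0.
  by move=> y z hy hz n; rewrite aut_iterB; exact: SB.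
- apply/seteqP; split => y.
    by move=> [z hz <-] n; rewrite -aut_iterSr; exact: hz.
  move=> hy; exists (aut_inv alpha y); last by rewrite aut_invK.
  by move=> n; have := hy (n - 1); rewrite -{1}(aut_invK alpha y) -aut_iterSr subrK.
- by move=> hT; apply: nSx; have : invariant_core S x by [rewrite hT]; move=> /(_ 0).
Qed.

Definition homoclinic (x : X) : Prop :=
  forall U, nbhs 0 U -> exists N : nat, forall n : int, (N <= `|n|)%N -> U (it n x).

(** A sequence in a finite set that tends to zero is eventually zero. *)
Lemma homoclinic_finite x (F : set X) : homoclinic x -> finite_set F ->
  (forall n, F (it n x)) -> x = 0.
Proof.
move=> hx finF Fx; pose F' := F `\ 0.
have cF' : closed F'.
  apply: (accessible_finite_set_closed.1 (hausdorff_accessible X_hausdorff)).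
  exact: finite_setD.
have U0 : nbhs (0 : X) (~` F').
  by apply: open_nbhs_nbhs; split; [exact: closed_openC|case=> _ /=; apply].
have [N hN] := hx _ U0; have := hN N%:Z (leqnn _).
apply: contra_notP => x0; split; first exact: Fx.
by move=> /= e; apply: x0; apply: (aut_iter_inj (n := N%:Z)); rewrite aut_iter0.
Qed.

Lemma homoclinic_mulz x m : homoclinic x -> homoclinic (x *~ m).
Proof.
move=> hx U U0.
have cm := @continuous_mulrz X m.
have [|N hN] := hx ((fun y : X => y *~ m) @^-1` U).
  by apply: cm; rewrite mul0rz.
by exists N => n nN; rewrite aut_iter_mulz; exact: hN.
Qed.

End automorphism.

(** * Integral relations between the iterates of a character *)

Section relations.
Context (X : topologicalZmodType) (R : realType) (theta : X -> R).
Hypothesis X_compact : compact [set: X].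
Hypothesis X_hausdorff : hausdorff_space X.
Hypothesis thetaP : angle theta.
Variable alpha : automorphism X.

Local Notation it := (aut_iter alpha).
Local Notation "p ^R" := (map_poly (intr : int -> R) p) (at level 2).

Definition poly_act (g : {poly int}) (x : X) : X :=
  \sum_(i < size g) it i%:Z x *~ g`_i.

Lemma poly_actB g x y : poly_act g (x - y) = poly_act g x - poly_act g y.
Proof.
by rewrite -sumrB; apply: eq_bigr => i _; rewrite aut_iterB mulrzBl.
Qed.

Lemma continuous_poly_act g : continuous (poly_act g).
Proof.
rewrite /poly_act; elim: (index_enum _) => [|i r ih].
  by under eq_fun do rewrite big_nil; exact: cts_const.
under eq_fun do rewrite big_cons; apply: cts_addX => //.
apply: (@cts_comp _ _ _ (it i%:Z) (fun y => y *~ g`_i)).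
  exact: aut_iter_continuous.
exact: continuous_mulrz.
Qed.

Definition itinerary (x : X) (n : int) : R := theta (it n x).

Lemma itinerary_vanishes x : homoclinic alpha x -> vanishes (itinerary x).
Proof.
move=> hx e e0; have [N hN] := hx _ (angle_small thetaP e0).
by exists N.
Qed.

Lemma angle_poly_act g x n :
  theta (poly_act g (it n x)) - pact g^R (itinerary x) n \is a Num.int.
Proof.
rewrite (@pactE _ (size g)) ?size_poly//.
under eq_bigr do rewrite coef_map /itinerary addrC aut_iterD /=.
have h : \sum_(i < size g) (theta (it i%:Z (it n x) *~ g`_i) -
    (g`_i)%:~R * theta (it i%:Z (it n x))) \is a Num.int.
  by apply: rpred_sum => i _; exact: angleMz.
have := rpredD (angle_sum thetaP (index_enum 'I_(size g))
  (fun i => it i%:Z (it n x) *~ g`_i)) h.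
by rewrite sumrB addrA subrK.
Qed.

(** [g] is a relation when the character is trivial on the image of [g(alpha)]. *)
Definition relation (g : {poly int}) : Prop :=
  forall x, theta (poly_act g x) \is a Num.int.

(** A point can be replaced by any of its iterates. In this form it is clear that
    relations form an ideal. *)
Lemma relationP g : relation g <->
  forall x n, pact g^R (itinerary x) n \is a Num.int.
Proof.
split=> [rg x n|rg x].
  by have := rpredB (rg (it n x)) (angle_poly_act g x n); rewrite subKr.
by have := rpredD (angle_poly_act g x 0) (rg x 0); rewrite subrK.
Qed.

Lemma relation_core_finite g : irreducible alpha -> ~ relation g ->
  finite_set (invariant_core alpha [set x | theta (poly_act g x) \is a Num.int]).
Proof.
move=> irr rg; apply: invariant_core_finite => //.
- rewrite (_ : mkset _ = (fun x => cos_turn (theta (poly_act g x))) @^-1` [set 1]).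
    have : continuous (fun x => cos_turn (theta (poly_act g x))).
      exact: cts_comp (@continuous_poly_act g) (angle_cos thetaP).
    by move=> /continuous_closedP; apply; exact: closed_eq.
  apply/seteqP; split => x /=; last exact: cos_turn_eq1.
  by move=> /cos_turn_int[].
- split.
    by rewrite /= -(subrr 0) poly_actB subrr (angle0 thetaP).
  move=> x y /= hx hy; rewrite poly_actB.
  have := rpredD (angleD thetaP (poly_act g x) (- poly_act g y))
    (rpredB (rpredD (angleN thetaP (poly_act g y)) hx) hy).
  by apply: int_num_eq; ring.
- by apply: contrapT => h; apply: rg => x; apply: contrapT => hx; apply: h; exists x.
Qed.

Hypothesis X_connected : connected [set: X].
Hypothesis theta_nontrivial : exists x, theta x \isn't a Num.int.

(** If an integer multiple of the character is trivial then its kernel is open,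
    being closed as well; this contradicts connectedness. *)
Lemma angle_not_torsion (m : int) : m != 0 -> exists x,
  m%:~R * theta x \isn't a Num.int.
Proof.
move=> m0; apply: contrapT => h.
have mth x : m%:~R * theta x \is a Num.int.
  by apply/negPn/negP => hx; apply: h; exists x.
have [x0 nx0] := theta_nontrivial; move: nx0; apply/negP/negPn.
suff /seteqP[_ /(_ x0 I)] : [set x | theta x \is a Num.int] = setT by [].
have m1 : 0 < `|m|%:~R :> R by rewrite ltr0z normr_gt0.
apply: X_connected; first by exists 0; rewrite /= (angle0 thetaP).
- exists [set x | theta x \is a Num.int]; last by rewrite setTI.
  rewrite openE => x /= hx; rewrite /interior.
  have Mi0 : 0 < (`|m|%:~R : R)^-1 by rewrite invr_gt0.
  have cs : continuous (fun y : X => y - x) by cts.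
  have : nbhs x [set y | `|theta (y - x)| < (`|m|%:~R : R)^-1].
    have := cs x; rewrite /continuous_at subrr => csx.
    exact: csx _ (angle_small thetaP Mi0).
  apply: filterS => y /= hy.
  have ti : theta (y - x) = 0.
    have : `|m%:~R * theta (y - x)| < 1.
      by rewrite normrM -intr_norm mulrC -ltr_pdivlMr// mul1r.
    move=> /(int_num_lt1 (mth (y - x)))/eqP.
    by rewrite mulf_eq0 intr_eq0 (negPf m0) => /eqP.
  have := rpredD (angleD thetaP (y - x) x) hx; rewrite subrK ti.
  by apply: int_num_eq; ring.
- exists [set x | theta x \is a Num.int]; last by rewrite setTI.
  rewrite (_ : mkset _ = (fun x => cos_turn (theta x)) @^-1` [set 1]).
    by move/continuous_closedP: (angle_cos thetaP); apply; exact: closed_eq.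
  apply/seteqP; split => x /=; last exact: cos_turn_eq1.
  by move=> /cos_turn_int[].
Qed.

Lemma minimal_relation : (exists2 f, f != 0 & relation f) ->
  exists f, [/\ f != 0, relation f &
    forall g, relation g -> g != 0 -> (size f <= size g)%N].
Proof.
move=> [f0 f00 rf0]; pose P n := `[< exists f, [/\ f != 0, relation f & size f = n] >].
have exP : exists n, P n by exists (size f0); apply/asboolP; exists f0.
have [n /asboolP[f [fn0 rf sf]] nmin] := ex_minnP exP.
exists f; split => // g rg g0; rewrite sf; apply: nmin; apply/asboolP.
by exists g.
Qed.

(** Pseudo-division by [f]: the remainder is a relation of smaller degree. *)
Lemma relation_multiple f g : f != 0 -> relation f ->
  (forall h, relation h -> h != 0 -> (size f <= size h)%N) -> relation g ->
  exists K q, K != 0 /\ K *: g = q * f.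
Proof.
move=> f0 rf fmin rg; pose K := lead_coef f ^+ Pdiv.Idomain.scalp g f.
exists K, (g %/ f); split; first by rewrite expf_neq0// lead_coef_eq0.
have gE := Pdiv.Idomain.divp_eq g f; rewrite -/K in gE.
suff r0 : g %% f = 0 by rewrite gE r0 addr0.
apply/eqP/negPn/negP => r0; have := fmin _ _ r0.
rewrite leqNgt ltn_modp f0; suff rr : relation (g %% f) by move/(_ rr).
apply/relationP => x n.
have -> : g %% f = K%:P * g - (g %/ f) * f by rewrite mul_polyC gE addrC addKr.
rewrite rmorphB !rmorphM /= map_polyC /=.
rewrite -mulN1r -[-1]/(- 1%:P) -polyCN pactD !pactCM pactM mulN1r rpredB//.
  by rewrite rpredM ?intr_int//; move/relationP : rg.
apply: rpred_sum => i _; rewrite rpredM//; last by move/relationP : rf.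
by rewrite coef_map /= intr_int.
Qed.

End relations.

(** * Homoclinic points when there is a relation *)

Lemma real_vanishing_recurrence (R : realType) (f : {poly int}) (w : int -> R) :
  f != 0 -> vanishes w -> (forall n, pact (map_poly intr f) w n = 0) ->
  forall n, w n = 0.
Proof.
move=> f0 w0 fw n; pose wc n := (w n)%:C%C.
pose p : {poly R[i]} := map_poly (real_complex R) (map_poly intr f).
suff : wc n = 0 by move=> /(congr1 (@complex.Re R)).
apply: (@vanishing_recurrence _ p) => {n}.
- apply: contraNneq f0 => /(congr1 (fun r : {poly R[i]} => r`_(size f).-1)).
  rewrite !coef_map coef0 /= => /(congr1 (@complex.Re R)) /= /eqP.
  by rewrite intr_eq0 -lead_coefE lead_coef_eq0.
- move=> e; rewrite ltcE /= => /andP[/eqP e0 ep].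
  have [N hN] := w0 _ ep; exists N => n nN.
  rewrite normc_def /= expr0n addr0 sqrtr_sqr ltcE /= e0 eqxx.
  exact: hN.
- move=> n; rewrite (@pactE _ (size f)); last first.
    by rewrite (leq_trans (size_poly _ _))// size_poly.
  have := congr1 (real_complex R) (fw n); rewrite (@pactE _ (size f)) ?size_poly//.
  rewrite rmorph_sum rmorph0 /=; apply: etrans.
  by apply: eq_bigr => i _; rewrite coef_map rmorphM.
Qed.

(** The coefficients of [q], read backwards, form the sequence [h]. *)
Lemma reflect_multiple (f q : {poly int}) (g : int -> int) (N : nat) (K : int) :
  (forall j : int, (N <= `|j|)%N -> g j = 0) ->
  K *: reflect_poly g N = q * f ->
  exists h : int -> int, (exists M : nat, forall j : int, (M <= `|j|)%N -> h j = 0) /\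
    forall n, pact f h n = K * g n.
Proof.
move=> g0 Kg; pose h (n : int) := if n <= N%:Z - 1 then q`_`|(N%:Z - 1 - n)%R| else 0.
exists h; split.
  have [s sq] : exists s, size q = s by exists (size q).
  exists (N + s).+1 => j hj; rewrite /h; case: ifP => // jN.
  rewrite nth_default//; apply: (@leq_trans s); first by rewrite -sq.
  by clear -hj jN; lia.
move=> n; have [nN|nN] := leP n (N%:Z - 1); last first.
  rewrite g0 ?mulr0; last by lia.
  apply: big1 => i _; rewrite /h ifF ?mulr0//; lia.
(* the coefficient of [q * f] in degree [J] is the value at [n] *)
pose J := `|(N%:Z - 1 - n)%R|%N; have nE : n = N%:Z - 1 - J%:Z by rewrite /J; lia.
have -> : K * g n = (q * f)`_J.
  rewrite -Kg coefZ coef_poly -nE; case: ifP => // JN.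
  by rewrite g0//; lia.
rewrite coefMr (@pactE _ (size f + J.+1)) ?leq_addr//.
rewrite (big_ord_widen (size f + J.+1) (fun i => q`_(J - i) * f`_i)) ?leq_addl//.
rewrite [RHS]big_mkcond /=; apply: eq_bigr => i _; rewrite ltnS.
case: leqP => iJ.
  rewrite mulrC /h ifT; last by lia.
  by congr (q`_ _ * _); lia.
by rewrite /h ifF ?mulr0//; lia.
Qed.

Section homoclinic.
Context (X : topologicalZmodType) (R : realType) (theta : X -> R).
Hypothesis X_compact : compact [set: X].
Hypothesis X_hausdorff : hausdorff_space X.
Hypothesis X_connected : connected [set: X].
Hypothesis thetaP : angle theta.
Hypothesis theta_nontrivial : exists x, theta x \isn't a Num.int.
Variable alpha : automorphism X.
Hypothesis alpha_irreducible : irreducible alpha.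

Local Notation it := (aut_iter alpha).
Local Notation "p ^R" := (map_poly (intr : int -> R) p) (at level 2).
Local Notation itin := (itinerary theta alpha).
Local Notation rel := (relation theta alpha).

(** Let [G] be the reflected polynomial. If it is not a relation then the points
    whose orbit is annihilated by [G] modulo one form a finite set. Points
    with a small orbit belong to it: the integral sequence [f (itin y)] is small,
    hence zero, and then [G (itin y)] is zero by the pairing with the homoclinic
    point. So only [0] has a small orbit, which is expansiveness. *)
Lemma reflect_relation (f : {poly int}) (g : int -> int) (N : nat) (x : X) :
  ~ expansive alpha -> rel f -> homoclinic alpha x ->
  (forall n, pact f^R (itin x) n = (g n)%:~R) ->
  (forall j : int, (N <= `|j|)%N -> g j = 0) ->
  rel (reflect_poly g N).
Proof.
move=> nexp rf hx fg g0; apply: contrapT => nrel; apply: nexp.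
have finF := relation_core_finite X_compact X_hausdorff thetaP alpha_irreducible nrel.
set F := invariant_core _ _ in finF.
pose S := \sum_(i < size f^R) `|f^R`_i|; have S0 : 0 <= S by exact: sumr_ge0.
have S1 : 0 < S + 1 by rewrite ltr_wpDl.
have e0 : 0 < (S + 1)^-1 by rewrite invr_gt0.
have cF : closed (F `\ 0).
  apply: (accessible_finite_set_closed.1 (hausdorff_accessible X_hausdorff)).
  exact: finite_setD.
exists ([set y | `|theta y| < (S + 1)^-1] `&` ~` (F `\ 0)).
  apply: filterI; first exact: angle_small.
  by apply: open_nbhs_nbhs; split; [exact: closed_openC|case=> _ /=; apply].
move=> a b hab; apply/eqP; rewrite -subr_eq0; apply/eqP; set y := a - b.
have hy n : `|itin y n| < (S + 1)^-1 /\ ~ (F `\ 0) (it n y).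
  by rewrite /itinerary /y aut_iterB; exact: hab.
have fy n : pact f^R (itin y) n = 0.
  apply: int_num_lt1; first by move/(relationP thetaP): rf; apply.
  apply: (@le_lt_trans _ _ (S * (S + 1)^-1)); last by rewrite ltr_pdivrMr// mul1r ltrDl.
  rewrite (le_trans (ler_norm_sum _ _ _))// mulr_suml; apply: ler_sum => i _.
  by rewrite normrM ler_wpM2l//; have [/ltW] := hy (n + i%:Z).
have Gy n : pact (reflect_poly g N)^R (itin y) n = 0.
  apply: (reflect_annihilates (itinerary_vanishes thetaP hx) (ltW e0) _ fy fg g0).
  by move=> k; have [/ltW] := hy k.
have Fy : F y.
  by move=> n /=; have := angle_poly_act thetaP alpha (reflect_poly g N) y n; rewrite Gy subr0.
by have [_] := hy 0; apply: contra_notP => y0; split.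
Qed.

(** Let [f] be a relation of least degree. The sequence [f (itin x)] is integral
    and vanishing, hence of finite support, and its reflection [G] is a relation,
    so that [K *: G = q * f]. Therefore [K * itin x] differs from an integral
    sequence of finite support by a vanishing solution of the recurrence [f],
    which is zero: the character is trivial on the orbit of [x *~ K]. By
    irreducibility such an orbit is finite, so [x *~ K = 0]; by irreducibility
    again the [K]-torsion is finite, so [x = 0]. *)
Theorem no_homoclinic (x : X) : ~ expansive alpha ->
  (exists2 f, f != 0 & rel f) -> homoclinic alpha x -> x = 0.
Proof.
move=> nexp /minimal_relation[f [f0 rf fmin]] hx.
have vx := itinerary_vanishes thetaP hx.
have fint n : pact f^R (itin x) n \is a Num.int by move/(relationP thetaP): rf; apply.
pose g n := Num.floor (pact f^R (itin x) n).
have fg n : pact f^R (itin x) n = (g n)%:~R by rewrite /g floorK.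
have [N hN] := vanishes_pact f^R vx ltr01.
have g0 (j : int) : (N <= `|j|)%N -> g j = 0.
  move=> jN; have := int_num_lt1 (fint j) (hN j jN); rewrite fg => /eqP.
  by rewrite intr_eq0 => /eqP.
have relG := reflect_relation nexp rf hx fg g0.
have [K [q [K0 Kg]]] := relation_multiple thetaP f0 rf fmin relG.
have [h [[M hM] fh]] := reflect_multiple g0 Kg.
have Kint n : K%:~R * itin x n \is a Num.int.
  suff -> : K%:~R * itin x n = (h n)%:~R by exact: intr_int.
  apply/eqP; rewrite -subr_eq0; apply/eqP.
  apply: (@real_vanishing_recurrence _ f (fun n => K%:~R * itin x n - (h n)%:~R)) => //.
    apply: vanishesB; first exact: vanishesZ.
    by apply: (@vanishes_finite _ _ M) => k kM; rewrite hM.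
  move=> k; rewrite pactBr pactZr fg -intrM -fh (@pactE _ (size f)) ?size_poly//.
  rewrite /pact -[X in _ - X](_ : (pact f h k)%:~R = _) ?subrr//.
  by rewrite /pact rmorph_sum; apply: eq_bigr => i _; rewrite coef_map rmorphM.
have Kx0 : x *~ K = 0.
  have nrel1 : ~ rel 1.
    have [z nz] := theta_nontrivial; move=> /(_ z).
    by rewrite /poly_act size_poly1 big_ord1 coef1 /= mulr1z => hz; rewrite hz in nz.
  have fin1 := relation_core_finite X_compact X_hausdorff thetaP alpha_irreducible nrel1.
  apply: (homoclinic_finite X_hausdorff (homoclinic_mulz K hx) fin1).
  move=> n m /=; rewrite /poly_act size_poly1 big_ord1 coef1 /= mulr1z.
  rewrite -aut_iterD aut_iter_mulz.
  have := rpredD (angleMz thetaP (it (m + n) x) K) (Kint (m + n)).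
  by rewrite subrK.
have [z nz] := angle_not_torsion thetaP X_connected theta_nontrivial K0.
have finK : finite_set (invariant_core alpha [set y | y *~ K = 0]).
  apply: invariant_core_finite => //.
  - rewrite (_ : mkset _ = (fun y => y *~ K) @^-1` [set 0])//.
    have /continuous_closedP := @continuous_mulrz X K; apply.
    exact: accessible_closed_set1 (hausdorff_accessible X_hausdorff) _.
  - split; first by rewrite /= mul0rz.
    by move=> a b /= a0 b0; rewrite mulrzBl a0 b0 subr0.
  - exists z => /= Kz; move: nz; apply/negP/negPn.
    by have := angleMz thetaP z K; rewrite Kz (angle0 thetaP) sub0r rpredN.
apply: (homoclinic_finite X_hausdorff hx finK) => n m /=.
by rewrite -!aut_iter_mulz Kx0 !aut_iter0.
Qed.

End homoclinic.

(** * Existence of a relation *)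

Section fejer.
Context (R : realType).
Implicit Types t : R.

(** The Fejer kernel: nonnegative, of mean one, and small away from integers. *)
Definition fejer (n : nat) t : R :=
  n%:R^-1 * \sum_(a < n) \sum_(b < n) cos_turn ((a%:R - b%:R) * t).

Lemma fejerE n t : fejer n t = n%:R^-1 *
  ((\sum_(a < n) cos_turn (a%:R * t)) ^+ 2 + (\sum_(a < n) sin_turn (a%:R * t)) ^+ 2).
Proof.
congr (_ * _); rewrite !expr2 !mulr_suml -big_split; apply: eq_bigr => a _.
rewrite !mulr_sumr -big_split; apply: eq_bigr => b _ /=.
by rewrite mulrBl cos_turnD cos_turnN sin_turnN; ring.
Qed.

Lemma fejer_ge0 n t : 0 <= fejer n t.
Proof. by rewrite fejerE mulr_ge0 ?invr_ge0// addr_ge0 ?sqr_ge0. Qed.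

(** A geometric sum: [(1 - e(t)) * \sum_(a < n) e(a t) = 1 - e(n t)], where [e] is
    the complex exponential; [hC] and [hS] are its real and imaginary parts. *)
Lemma fejer_far n t (d : R) : (0 < n)%N -> 0 < d -> d <= 1 - cos_turn t ->
  fejer n t <= 2 / d / n%:R.
Proof.
move=> n0 d0 dt; rewrite fejerE.
set C := \sum_(a < n) cos_turn _; set S := \sum_(a < n) sin_turn _.
have [hC hS] : (1 - cos_turn t) * C + sin_turn t * S = 1 - cos_turn (n%:R * t) /\
    (1 - cos_turn t) * S - sin_turn t * C = - sin_turn (n%:R * t).
  rewrite /C /S; elim: n {n0 C S} => [|n [ihC ihS]].
    by rewrite !big_ord0 mul0r cos_turn_0 sin_turn_0; split; ring.
  have -> : n.+1%:R * t = n%:R * t + t by rewrite -natr1; ring.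
  by rewrite !big_ord_recr /= cos_turnD sin_turnD; split; lra.
have h1 := cos_turn_sin_turn t; have h2 := cos_turn_sin_turn (n%:R * t).
have hCS : (2 - 2 * cos_turn t) * (C ^+ 2 + S ^+ 2) = 2 - 2 * cos_turn (n%:R * t).
  have -> : 2 - 2 * cos_turn t = (1 - cos_turn t) ^+ 2 + sin_turn t ^+ 2 by lra.
  have -> : 2 - 2 * cos_turn (n%:R * t) = (1 - cos_turn (n%:R * t)) ^+ 2 + (- sin_turn (n%:R * t)) ^+ 2 by lra.
  by rewrite -hC -hS; ring.
have cn : -1 <= cos_turn (n%:R * t) by exact: cos_geN1.
rewrite mulrC ler_pM2r ?invr_gt0 ?ltr0n// ler_pdivlMr//.
have CS0 : 0 <= C ^+ 2 + S ^+ 2 by rewrite addr_ge0 ?sqr_ge0.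
by nra.
Qed.

End fejer.

Section independence.
Context (X : topologicalZmodType) (R : realType) (theta : X -> R).
Hypothesis X_compact : compact [set: X].
Hypothesis X_hausdorff : hausdorff_space X.
Variable I : (X -> R) -> R.
Hypothesis IP : invariant_mean I.
Hypothesis thetaP : angle theta.
Variable alpha : automorphism X.

Local Notation it := (aut_iter alpha).
Local Notation rel := (relation theta alpha).

Let phase (g : {poly int}) (s : R) (x : X) : R := cos_turn (theta (poly_act alpha g x) + s).

Let cts_phase g s : continuous (phase g s).
Proof.
rewrite (_ : phase g s = fun x => cos_turn (theta (poly_act alpha g x)) * cos_turn s -
  sin_turn (theta (poly_act alpha g x)) * sin_turn s); last first.
  by apply/funext => x; rewrite /phase cos_turnD.
have cg := @continuous_poly_act _ X_compact X_hausdorff alpha g.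
have c1 := cts_comp cg (angle_cos thetaP).
have c2 := cts_comp cg (angle_sin thetaP).
by cts.
Qed.

Lemma cos_turn_congr (t u : R) : t - u \is a Num.int -> cos_turn t = cos_turn u /\ sin_turn t = sin_turn u.
Proof.
move=> /cos_turn_int[c s]; rewrite -(subrK u t); move: (t - u) c s => d c s.
by rewrite cos_turnD sin_turnD c s; split; ring.
Qed.

Lemma poly_actD g x y : poly_act alpha g (x + y) = poly_act alpha g x + poly_act alpha g y.
Proof.
by rewrite -big_split; apply: eq_bigr => i _; rewrite aut_iter_add mulrzDl.
Qed.

Lemma poly_actE m (g : {poly int}) x : (size g <= m)%N ->
  poly_act alpha g x = \sum_(i < m) it i%:Z x *~ g`_i.
Proof.
move=> gm; rewrite /poly_act (big_ord_widen m (fun i => it i%:Z x *~ g`_i))//.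
rewrite [RHS](bigID (fun i : 'I_m => (i < size g)%N))/= [X in _ + X]big1 ?addr0//.
by move=> i; rewrite -leqNgt => gi; rewrite nth_default// mulr0z.
Qed.

Lemma poly_act_add g h x : poly_act alpha (g + h) x = poly_act alpha g x + poly_act alpha h x.
Proof.
pose m := maxn (size g) (size h).
rewrite !(@poly_actE m) ?leq_maxl ?leq_maxr// ?(leq_trans (size_polyD _ _))//.
by rewrite -big_split; apply: eq_bigr => i _; rewrite coefD mulrzDr.
Qed.

Lemma poly_act_monomial (m : int) (j : nat) x :
  poly_act alpha (m *: 'X^j) x = it j%:Z x *~ m.
Proof.
rewrite (@poly_actE j.+1); last by rewrite (leq_trans (size_scale_leq _ _))// size_polyXn.
rewrite (bigD1 ord_max)//= coefZ coefXn eqxx mulr1 big1 ?addr0// => i ij.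
rewrite coefZ coefXn (_ : (i == j :> nat) = false) ?mulr0 ?mulr0z//.
by apply/negbTE; move: ij; apply: contraNneq => ij; apply/eqP/val_inj.
Qed.

(** Translating by a point where the character differs from one multiplies its
    mean by a number different from one. *)
Lemma phase_mean0 g s : ~ rel g -> I (phase g s) = 0.
Proof.
move=> rg; have [a na] : exists a, theta (poly_act alpha g a) \isn't a Num.int.
  apply: contrapT => h; apply: rg => x; apply/negPn/negP => hx; apply: h.
  by exists x.
pose C := phase g s; pose S := phase g (s - 1 / 4).
(* a quarter turn exchanges cosine and sine *)
have quarter t : cos_turn (t + (s - 1 / 4)) = sin_turn (t + s).
  have -> : t + (s - 1 / 4) = (t + s) - 1 / 4 by ring.
  rewrite /cos_turn /sin_turn mulrBl (_ : 1 / 4 * (pi *+ 2) = pi / 2) ?cosBpihalf//.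
  by rewrite -mulr_natr; field.
set c := cos_turn (theta (poly_act alpha g a)); set d := sin_turn (theta (poly_act alpha g a)).
have shift x : C (x + a) = c * C x + (- d) * S x /\ S (x + a) = c * S x + d * C x.
  have hh : (theta (poly_act alpha g (x + a)) + s) -
      ((theta (poly_act alpha g x) + s) + theta (poly_act alpha g a)) \is a Num.int.
    apply: int_num_eq (angleD thetaP (poly_act alpha g x) (poly_act alpha g a)).
    by rewrite poly_actD; ring.
  have [e1 e2] := cos_turn_congr hh.
  rewrite /C /S /phase !quarter e1 e2.
  move: (theta _ + s) => t; rewrite cos_turnD sin_turnD -/c -/d.
  by split; ring.
have cC : continuous C by exact: cts_phase.
have cS : continuous S by exact: cts_phase.
have hC : I C = c * I C + (- d) * I S.
  rewrite -[LHS](mean_shift IP a cC) -!(meanZ IP)// -(meanD IP); [|by cts..].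
  by congr I; apply/funext => x; have [] := shift x.
have hS : I S = c * I S + d * I C.
  rewrite -[LHS](mean_shift IP a cS) -!(meanZ IP)// -(meanD IP); [|by cts..].
  by congr I; apply/funext => x; have [] := shift x.
have cd : c ^+ 2 + d ^+ 2 = 1 by exact: cos_turn_sin_turn.
have c1 : c != 1 by apply: contra na => /eqP /cos_turn_eq1.
have : (2 - 2 * c) * I C = 0.
  have -> : (2 - 2 * c) * I C = (1 - c) * (I C - (c * I C + (- d) * I S))
    - d * (I S - (c * I S + d * I C)).
    transitivity ((1 - 2 * c + (c ^+ 2 + d ^+ 2)) * I C); first by rewrite cd; ring.
    by ring.
  by rewrite -hC -hS !subrr; ring.
move/eqP; rewrite mulf_eq0 => /orP[/eqP h|/eqP //].
have c11 : c = 1 by lra.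
by rewrite c11 eqxx in c1.
Qed.

Hypothesis independent : forall g, g != 0 -> ~ rel g.

Lemma phase_mean g s : I (phase g s) = (g == 0)%:R * cos_turn s.
Proof.
have [->|g0] := eqVneq g 0; last by rewrite mul0r phase_mean0//; exact: independent.
rewrite mul1r -[RHS](mean_cst IP); congr I; apply/funext => x.
by rewrite /phase /poly_act size_poly0 big_ord0 (angle0 thetaP) add0r.
Qed.

Lemma phase_monomial (m : int) j tau x :
  cos_turn (m%:~R * (theta (it j%:Z x) - tau)) = phase (m *: 'X^j) (- (m%:~R * tau)) x.
Proof.
rewrite /phase poly_act_monomial.
have hh : (m%:~R * (theta (it j%:Z x) - tau)) -
    (theta (it j%:Z x *~ m) - m%:~R * tau) \is a Num.int.
  have := angleMz thetaP (it j%:Z x) m; rewrite -rpredN.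
  by apply: int_num_eq; ring.
by have [-> _] := cos_turn_congr hh.
Qed.

(** The Fejer kernels along the orbit of [x], peaked where the angles of all the
    iterates [j] in [J] are close to [tau]. *)
Let kernel (n : nat) (tau : R) (J : seq nat) (x : X) : R :=
  \prod_(j <- J) fejer n (theta (it j%:Z x) - tau).

Let fejer_phase n tau j x : fejer n (theta (it j%:Z x) - tau) =
  n%:R^-1 * \sum_(a < n) \sum_(b < n)
    phase ((a%:Z - b%:Z) *: 'X^j) (- ((a%:Z - b%:Z)%:~R * tau)) x.
Proof.
congr (_ * _); apply: eq_bigr => a _; apply: eq_bigr => b _.
by rewrite -phase_monomial rmorphB.
Qed.

Let cts_kernel n tau J : continuous (kernel n tau J).
Proof.
rewrite /kernel; elim: J => [|j J ih].
  by under eq_fun do rewrite big_nil; exact: cts_const.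
under eq_fun do rewrite big_cons fejer_phase.
apply: cts_mul => //; apply: cts_mul; first exact: cts_const.
by apply: cts_sum => a; apply: cts_sum => b; exact: cts_phase.
Qed.

(** When distinct iterates of the character are independent, all the products of
    nontrivial characters occurring in the expansion of the kernels have mean
    zero. The condition on [g] ensures that the terms of the expansion for
    different [j] do not cancel each other. *)
Lemma kernel_mean n tau J (g : {poly int}) s : (0 < n)%N -> uniq J ->
  (forall j, j \in J -> g`_j = 0) ->
  I (fun x => phase g s x * kernel n tau J x) = (g == 0)%:R * cos_turn s.
Proof.
move=> n0; elim: J g s => [|j J ih] g s.
  move=> _ _; rewrite -phase_mean; congr I; apply/funext => x.
  by rewrite /kernel big_nil mulr1.
move=> /= /andP[jJ uJ] gJ.
(* [h m] collects the frequency [m] of the kernel at [j]; it is zero only if both terms are *)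
pose h (m : int) := g + m *: 'X^j.
have hJ m i : i \in J -> (h m)`_i = 0.
  move=> iJ; rewrite coefD gJ ?inE ?iJ ?orbT// add0r coefZ coefXn.
  by case: eqP => [ij|_]; rewrite ?mulr0//; rewrite ij (negPf jJ) in iJ.
have h0 m : (h m == 0) = (g == 0) && (m == 0).
  apply/eqP/andP => [hm|[/eqP g00 /eqP m0]]; last by rewrite /h g00 m0 scale0r addr0.
  have m0 : m = 0.
    have := congr1 (fun p : {poly int} => p`_j) hm.
    by rewrite coefD coefZ coefXn eqxx mulr1 coef0 gJ ?inE ?eqxx// add0r.
  by move: hm; rewrite /h m0 scale0r addr0 => ->.
have prod m u x : phase g s x * phase (m *: 'X^j) u x =
    1 / 2 * (phase (h m) (s + u) x + phase (h (- m)) (s - u) x).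
  rewrite /phase /h !poly_act_add !poly_act_monomial.
  set A := poly_act alpha g x; set B := it j%:Z x.
  have h1 : (theta (A + B *~ m) + (s + u)) -
      ((theta A + s) + (theta (B *~ m) + u)) \is a Num.int.
    by apply: int_num_eq (angleD thetaP A (B *~ m)); ring.
  have h2 : (theta (A - B *~ m) + (s - u)) -
      ((theta A + s) - (theta (B *~ m) + u)) \is a Num.int.
    have := rpredD (angleD thetaP A (- (B *~ m))) (angleN thetaP (B *~ m)).
    by apply: int_num_eq; ring.
  have [e1 _] := cos_turn_congr h1; have [e2 _] := cos_turn_congr h2.
  rewrite mulrNz e1 e2 [cos_turn (_ + s + _)]cos_turnD [cos_turn (_ + s - _)]cos_turnD cos_turnN sin_turnN.
  by field.
pose T a b (x : X) := phase (h (a%:Z - b%:Z)) (s - (a%:Z - b%:Z)%:~R * tau) x * kernel n tau J x.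
pose T' a b (x : X) := phase (h (- (a%:Z - b%:Z))) (s + (a%:Z - b%:Z)%:~R * tau) x * kernel n tau J x.
have cT a b : continuous (T a b) by apply: cts_mul; [exact: cts_phase|exact: cts_kernel].
have cT' a b : continuous (T' a b) by apply: cts_mul; [exact: cts_phase|exact: cts_kernel].
have IT (a b : nat) : I (T a b) = ((g == 0) && (a == b))%:R * cos_turn s.
  rewrite ih//; last by move=> i iJ; exact: hJ.
  rewrite h0 subr_eq0 eqz_nat; have [->|_] := eqVneq a b; last by rewrite !andbF !mul0r.
  by rewrite subrr mul0r subr0.
have IT' (a b : nat) : I (T' a b) = ((g == 0) && (a == b))%:R * cos_turn s.
  rewrite ih//; last by move=> i iJ; exact: hJ.
  rewrite h0 oppr_eq0 subr_eq0 eqz_nat; have [->|_] := eqVneq a b; last by rewrite !andbF !mul0r.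
  by rewrite subrr mul0r addr0.
have -> : (fun x => phase g s x * kernel n tau (j :: J) x) =
    fun x => n%:R^-1 * \sum_(a < n) \sum_(b < n) (1 / 2 * (T a b x + T' a b x)).
  apply/funext => x; rewrite /kernel big_cons fejer_phase -/(kernel n tau J x).
  rewrite mulrA mulrCA -mulrA; congr (_ * _).
  rewrite mulr_sumr mulr_suml; apply: eq_bigr => a _.
  rewrite mulr_sumr mulr_suml; apply: eq_bigr => b _.
  by rewrite prod opprK /T /T'; ring.
have cTT a b : continuous (fun x => 1 / 2 * (T a b x + T' a b x)).
  by have := cT a b; have := cT' a b => ? ?; cts.
rewrite (meanZ IP); last by apply: cts_sum => a; apply: cts_sum => b; exact: cTT.
rewrite (mean_sum IP); last by move=> a; apply: cts_sum => b; exact: cTT.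
rewrite (eq_bigr (fun=> (g == 0)%:R * cos_turn s)).
  by rewrite sumr_const card_ord -[X in _ * X]mulr_natl mulKf// pnatr_eq0 -lt0n.
move=> a _; rewrite (mean_sum IP); last by move=> b; exact: cTT.
rewrite (bigD1 a)//= big1 ?addr0.
  rewrite (meanZ IP) ?(meanD IP)//; last by apply: cts_add.
  by rewrite IT IT' eqxx andbT; field.
move=> b ba; rewrite (meanZ IP) ?(meanD IP)//; last by apply: cts_add.
rewrite IT IT' (_ : (a == b :> nat) = false) ?andbF ?mul0r ?addr0 ?mulr0//.
by apply/negbTE; move: ba; apply: contraNneq => ab; apply/eqP/val_inj.
Qed.

(** Otherwise at each point some factor of the product of the kernels is at most
    [e], so that the product, of mean one, is bounded by a sum of [L] products
    with mean [e] each, where [L * e < 1]. *)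
Lemma orbit_window (tau d : R) (L : nat) : 0 < d ->
  exists x, forall j, (j < L)%N -> 1 - cos_turn (theta (it j%:Z x) - tau) < d.
Proof.
move=> d0; apply: contrapT => nx.
have bad x : exists2 j, (j < L)%N & d <= 1 - cos_turn (theta (it j%:Z x) - tau).
  apply: contrapT => h; apply: nx; exists x => j jL; rewrite ltNge; apply/negP => jd.
  by apply: h; exists j.
pose n := (Num.bound (2 / d * L%:R)).+1.
have n0 : (0 < n)%N by [].
have nL : 2 / d * L%:R < n%:R.
  have h0 : 0 <= 2 / d * L%:R by rewrite mulr_ge0// divr_ge0// ltW.
  by apply: lt_trans (archi_boundP h0) _; rewrite ltr_nat.
pose e := 2 / d / n%:R.
pose J := iota 0 L.
have mean1 (K : seq nat) : uniq K -> I (kernel n tau K) = 1.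
  move=> uK; have := @kernel_mean n tau K 0 0 n0 uK; rewrite eqxx mul1r cos_turn_0.
  move=> <-; last by move=> j _; rewrite coef0.
  congr I; apply/funext => x.
  by rewrite /phase /poly_act size_poly0 big_ord0 (angle0 thetaP) addr0 cos_turn_0 mul1r.
have k0 K x : 0 <= kernel n tau K x by apply: prodr_ge0 => j _; exact: fejer_ge0.
have : I (kernel n tau J) <= I (fun x => \sum_(j <- J) e * kernel n tau (rem j J) x).
  apply: (mean_le IP); first exact: cts_kernel.
    by apply: cts_sum => j; apply: cts_mul; [exact: cts_const|exact: cts_kernel].
  have e0 : 0 <= e by rewrite !divr_ge0// ltW.
  move=> x; have [j jL jd] := bad x.
  have jJ : j \in J by rewrite mem_iota.
  rewrite (big_rem j)//= ler_wpDr//; first by apply: sumr_ge0 => i _; rewrite mulr_ge0.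
  rewrite {1}/kernel (big_rem j)//=; apply: ler_wpM2r; first exact: k0.
  exact: fejer_far.
rewrite mean1 ?iota_uniq// (mean_sum IP); last first.
  by move=> j; apply: cts_mul; [exact: cts_const|exact: cts_kernel].
rewrite (eq_bigr (fun=> e)); last first.
  move=> j _; rewrite (meanZ IP); last exact: cts_kernel.
  by rewrite mean1 ?mulr1// rem_uniq// iota_uniq.
rewrite big_const_seq count_predT size_iota iter_addr addr0 -mulr_natr /e.
by rewrite mulrAC ler_pdivlMr ?ltr0n// mul1r leNgt nL.
Qed.

(** A cluster point of the solutions on longer and longer windows. *)
Lemma constant_orbit (tau : R) : exists x, forall n : int,
  theta (it n x) - tau \is a Num.int.
Proof.
pose defect (n : int) (x : X) : R := 1 - cos_turn (theta (it n x) - tau).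
have window k : exists x, forall n : int, (`|n| <= k)%N -> defect n x < k.+1%:R^-1.
  have [|x hx] := @orbit_window tau k.+1%:R^-1 k.*2.+1; first by rewrite invr_gt0.
  exists (it k%:Z x) => n nk; rewrite /defect -aut_iterD.
  have [m [mk ->]] : exists m : nat, (m < k.*2.+1)%N /\ n + k%:Z = m%:Z.
    by exists `|(n + k%:Z)%R|%N; split; lia.
  exact: hx.
have [u uP] := choice window.
have cd n : continuous (defect n).
  have ci : continuous (it n) by exact: aut_iter_continuous.
  have c1 := cts_comp ci (angle_cos thetaP).
  have c2 := cts_comp ci (angle_sin thetaP).
  rewrite (_ : defect n = fun x => 1 - (cos_turn (theta (it n x)) * cos_turn (- tau) -
    sin_turn (theta (it n x)) * sin_turn (- tau))); first by cts.
  by apply/funext => x; rewrite /defect cos_turnD.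
have [|x [_ ux]] := X_compact (F := u @ \oo) _; first exact: filterT.
exists x => n; apply: cos_turn_eq1.
have d_ge0 : 0 <= defect n x by rewrite subr_ge0; exact: cos_le1.
apply/eqP; rewrite eq_sym -subr_eq0 eq_le d_ge0 andbT leNgt; apply/negP => dx.
have d20 : 0 < defect n x / 2 by rewrite divr_gt0.
pose k0 := maxn `|n|%N (Num.bound (defect n x / 2)^-1).
have V : nbhs x [set y | defect n x / 2 < defect n y].
  apply: (cd n x [set r | defect n x / 2 < r]).
  by apply: open_nbhs_nbhs; split; [exact: open_gt|rewrite /=; lra].
have U : (u @ \oo) (u @` [set k | (k0 <= k)%N]) by exists k0 => // k; exists k.
have [_ [[k k0k <-] /=]] := ux _ _ U V.
apply/negP; rewrite -leNgt; apply: le_trans (ltW (uP k n _)) _.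
  exact: leq_trans (leq_maxl _ _) k0k.
rewrite -[leRHS]invrK lef_pV2 ?posrE ?invr_gt0 ?ltr0n//.
have h0 : 0 <= (defect n x / 2)^-1 by rewrite invr_ge0 ltW.
apply: le_trans (ltW (archi_boundP h0)) _; rewrite ler_nat.
exact: leq_trans (leq_maxr _ _) (leqW k0k).
Qed.

(** The invariant subgroup of points whose iterates all have the same angle is
    proper because ['X - 1] is not a relation, and infinite because that angle is
    arbitrary. *)
Lemma independent_not_irreducible : ~ irreducible alpha.
Proof.
move=> irr; pose g : {poly int} := 'X - 1.
have g0 : g != 0 by rewrite -size_poly_eq0 size_XsubC.
have := relation_core_finite X_compact X_hausdorff thetaP irr (independent g0).
set F := invariant_core _ _ => finF.
(* angles in ]0, 1/2], so distinct ones differ by a non-integer *)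
pose tau (k : nat) : R := k.+2%:R^-1.
have [x xP] := choice (fun k => constant_orbit (tau k)).
have Fx k : F (x k).
  move=> n /=.
  have := rpredD (angle_poly_act thetaP alpha g (x k) n)
    (rpredB (xP k (n + 1)) (xP k n)).
  apply: int_num_eq; rewrite (@pactE _ 2); last by rewrite (leq_trans (size_poly _ _))// size_XsubC.
  rewrite !big_ord_recl big_ord0 !coef_map !coefB !coefX !coef1 /= /itinerary.
  by rewrite addr0 [0 - 1]sub0r subr0 rmorphN rmorph1; ring.
have x_inj : injective x.
  move=> k l xkl; have := rpredB (xP k 0) (xP l 0); rewrite xkl.
  rewrite (_ : _ - _ - _ = tau l - tau k); last by ring.
  have tb m : 0 < tau m <= 1 / 2.
    by rewrite invr_gt0 ltr0n /= div1r lef_pV2 ?posrE// ler_nat.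
  move=> /int_num_lt1; have /andP[? ?] := tb k; have /andP[? ?] := tb l.
  rewrite ltr_norml => h; have /eqP : tau l - tau k = 0 by apply: h; lra.
  rewrite subr_eq0 => /eqP /invr_inj /eqP; rewrite eqr_nat => /eqP.
  by case.
have : finite_set (x @^-1` F).
  by apply: finite_preimage => // k l _ _; exact: x_inj.
rewrite (_ : x @^-1` F = setT); first exact: infinite_nat.
by apply/seteqP; split => // k _; exact: Fx.
Qed.

End independence.

(** * Cylinder sets *)

Section cylinders.
Context (A : finType).
Implicit Types y z : full_shift A.

Definition cylinder (z : full_shift A) (m : nat) : set (full_shift A) :=
  [set y | forall n : int, (`|n| <= m)%N -> y n = z n].

Lemma nbhs_coordinate z (i : int) : nbhs z [set y : full_shift A | y i = z i].
Proof.
have h : nbhs (z i : discrete_topology A) [set a | a = z i].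
  by rewrite nbhs_principalE; apply/principal_filterP.
exact: (@proj_continuous int (fun=> discrete_topology A) i z _ h).
Qed.

Lemma nbhs_cylinder z m : nbhs z (cylinder z m).
Proof.
have sub : [set y : full_shift A | forall n, n \in iota 0 m.+1 ->
    y n%:Z = z n%:Z /\ y (- n%:Z) = z (- n%:Z)] `<=` cylinder z m.
  move=> y yz n nm; have := yz `|n|%N; rewrite mem_iota /= ltnS nm => /(_ isT).
  by case: n {nm} => k [h1 h2]; rewrite ?NegzE.
apply: (@filterS _ (nbhs z) _ _ _ sub).
elim: (iota 0 m.+1) => [|n s ih].
  rewrite (_ : mkset _ = setT); first exact: (@filterT _ (nbhs z)).
  by apply/seteqP; split.
apply: (@filterS3 _ (nbhs z) _ _ _ _ _ _ ih (nbhs_coordinate z n%:Z) (nbhs_coordinate z (- n%:Z))).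
by move=> y h1 h2 h3 k; rewrite inE => /predU1P[->//|]; exact: h1.
Qed.

Lemma cylinder_nbhs z (W : set (full_shift A)) : nbhs z W ->
  exists m, cylinder z m `<=` W.
Proof.
pose G := filter_from [set: nat] (cylinder z).
have FG : Filter G.
  apply: filter_from_filter; first by exists 0%N.
  move=> m n _ _; exists (maxn m n) => // y yz; split => k hk; apply: yz.
    exact: leq_trans hk (leq_maxl _ _).
  exact: leq_trans hk (leq_maxr _ _).
suff Gz : G --> z by move=> /Gz[m _ h]; exists m.
apply/cvg_sup => i V; rewrite nbhsE => -[V0 [[P oP <-] V0z] sub].
by exists `|i|%N => // y yz; apply: sub => /=; rewrite yz.
Qed.

Lemma full_shift_compact : compact [set: full_shift A].
Proof.
have -> : [set: full_shift A] = [set f | forall i : int, [set: discrete_topology A] (f i)].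
  by apply/seteqP; split.
apply: (@tychonoff int (fun=> discrete_topology A) (fun=> setT)) => _.
by apply: finite_compact; exact: (@finite_finset A setT).
Qed.

End cylinders.

(** * Loops in a shift of finite type *)

Section finite_type.
Context (A : finType) (F : seq (seq A)).
Implicit Types y z : full_shift A.

Definition avoiding : set (full_shift A) :=
  [set y | forall w, w \in F -> ~ occurs w y].
Local Notation Z := avoiding.

Definition memory : nat := \max_(w <- F) size w.
Local Notation L := memory.

(** Membership in a shift of finite type is decided by windows of bounded length,
    which may be taken from different points. *)
Lemma window_local z : (forall n : int, exists y, Z y /\ exists n' : int,
    forall i : nat, (i < L)%N -> z (n + i%:Z) = y (n' + i%:Z)) -> Z z.
Proof.
move=> loc w wF [n nw]; have [y [Zy [n' hy]]] := loc n; apply: (Zy w wF).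
exists n'; rewrite -[RHS]nw; apply/eq_in_map => i; rewrite mem_iota /= add0n => iw.
by rewrite hy// (leq_trans iw)// /memory (big_rem w)//= leq_maxl.
Qed.

Lemma shift_closed z (k : int) : Z z -> Z (shift_iter k z).
Proof.
move=> Zz; apply: window_local => n; exists z; split => //; exists (n + k) => i _.
by rewrite /shift_iter addrAC.
Qed.

Lemma finite_type_closed : closed Z.
Proof.
rewrite -[Z]setCK; apply: open_closedC; rewrite openE => z nz.
have [w [wF [n nw]]] : exists w, w \in F /\ occurs w z.
  by apply: contrapT => h; apply: nz => w wF ow; apply: h; exists w.
apply: (@filterS _ (nbhs z) _ _ _ _ (nbhs_cylinder z (`|n| + size w)%N)).
move=> y yz Zy; apply: (Zy w wF); exists n; rewrite -[RHS]nw.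
apply/eq_in_map => i; rewrite mem_iota /= add0n => iw; apply: yz.
apply: (@leq_trans (`|n| + i)%N); first by clear; lia.
by rewrite leq_add2l ltnW.
Qed.

Lemma finite_type_compact : compact Z.
Proof. exact: subclosed_compact finite_type_closed (@full_shift_compact A) _. Qed.

(** A loop can be traversed any number of times without creating new windows. *)
Definition loop z (a : int) (q : nat) : Prop :=
  forall i : nat, (i < L)%N -> z (a + i%:Z) = z (a + q%:Z + i%:Z).

(** One more copy is spliced in at [a + q]: as the words at [a] and [a + q] agree,
    the old and the new point agree on an overlap of length [memory], and each
    window lies on one side of the splice. *)
Lemma insert_loop z a q k : Z z -> loop z a q ->
  exists y, [/\ Z y, loop y a q, forall n : int, n < a + q%:Z -> y n = z n,
    forall n : int, a + (q * k)%:Z <= n -> y n = z (n - (q * k)%:Z) &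
    forall n : int, a <= n < a + (q * k)%:Z -> y (n + q%:Z) = y n].
Proof.
move=> Zz la; elim: k => [|k [x [Zx lx x1 x2 x3]]].
  exists z; split => // n; rewrite muln0 ?subr0//.
  by lia.
pose y : full_shift A := fun n => if n < a + q%:Z then x n else x (n - q%:Z).
have y1 n : n < a + q%:Z -> y n = x n by rewrite /y => ->.
have y2 n : a + q%:Z <= n -> y n = x (n - q%:Z) by rewrite /y leNgt => /negbTE ->.
have y3 n : n < a + q%:Z + L%:Z -> y n = x n.
  move=> nL; have [/y1//|an] := ltP n (a + q%:Z); rewrite y2//.
  have [i [iL ->]] : exists i : nat, (i < L)%N /\ n = a + q%:Z + i%:Z.
    by exists `|(n - a - q%:Z)%R|%N; split; lia.
  by rewrite -lx//; congr x; lia.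
exists y; split.
- apply: window_local => n; exists x; split => //.
  have [na|na] := ltP n (a + q%:Z).
    by exists n => i iL; apply: y3; lia.
  by exists (n - q%:Z) => i iL; rewrite y2; [congr x; lia|lia].
- move=> i iL; rewrite y3; last by lia.
  by rewrite y2; [congr x; lia|lia].
- by move=> n na; rewrite y1// x1.
- move=> n; rewrite mulnS => na; rewrite y2; last by lia.
  by rewrite x2; [congr z; lia|lia].
- move=> n; rewrite mulnS => /andP[an na]; rewrite y2; last by lia.
  rewrite addrK; have [nq|nq] := ltP n (a + q%:Z); first by rewrite y1.
  by rewrite y2// -[RHS]x3; [congr x; lia|lia].
Qed.

Definition word_count : nat := #|{ffun 'I_L -> A}|.
Local Notation N := word_count.

(** The pigeonhole principle for the words at [word_count + 1] places. *)
Lemma exists_loop z (b : int) : exists a q,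
  [/\ b <= a <= b + N%:Z, (0 < q <= N)%N & loop z a q].
Proof.
pose word (i : 'I_N.+1) := [ffun l : 'I_L => z (b + (i : nat)%:Z + (l : nat)%:Z)].
have /injectivePn[i [j ij wij]] : ~~ injectiveb word.
  by apply/negP => /injectiveP /leq_card; rewrite card_ord ltnn.
wlog ltij : i j ij wij / (i < j)%N.
  move=> h; have [ltij|ltji|/val_inj eij] := ltngtP i j; first exact: (h i j).
    by apply: (h j i) => //; rewrite eq_sym.
  by rewrite eij eqxx in ij.
have jN := ltn_ord j; exists (b + (i : nat)%:Z), (j - i)%N; split; [lia|lia|].
move=> l lL; have := congr1 (fun f : {ffun 'I_L -> A} => f (Ordinal lL)) wij.
by rewrite !ffunE /= => ->; congr z; lia.
Qed.

(** A common multiple of the lengths of all loops. *)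
Definition period : nat := N`!.
Local Notation p := period.

Lemma period_gt0 : (0 < p)%N. Proof. exact: fact_gt0. Qed.

(** The length of the insertion depends only on [k], whatever loop is found after
    [b]; so insertions at different places can be compared. *)
Lemma exists_insert z (b : int) (k : nat) : Z z ->
  exists y (a : int), [/\ Z y, b <= a <= b + N%:Z, forall n : int, n <= a -> y n = z n &
    forall n : int, a + (p * k)%:Z <= n -> y n = z (n - (p * k)%:Z)].
Proof.
move=> Zz; have [a [q [ab /andP[q0 qN] la]]] := exists_loop z b.
have /dvdnP[r pr] : (q %| p)%N by apply: dvdn_fact; rewrite q0.
have [y [Zy _ y1 y2 _]] := insert_loop (r * k)%N Zz la.
exists y, a; split => //; first by move=> n na; apply: y1; lia.
by move=> n; rewrite pr -mulnA mulnCA; exact: y2.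
Qed.

(** Traversing a loop forever in both directions gives the periodic point [w]. *)
Lemma exists_periodic z : Z z -> exists (w : full_shift A) (a : int),
  [/\ Z w, forall n : int, w (n + p%:Z) = w n &
    forall k, exists y, [/\ Z y, forall n : int, n <= a -> y n = z n,
      forall n : int, a + (p * k)%:Z <= n -> y n = z (n - (p * k)%:Z) &
      forall n : int, a <= n < a + (p * k)%:Z -> y n = w n]].
Proof.
move=> Zz; have [a [q [_ /andP[q0 qN] la]]] := exists_loop z 0.
have /dvdnP[r pr] : (q %| p)%N by apply: dvdn_fact; rewrite q0.
pose w : full_shift A := fun n => z (a + ((n - a) %% q%:Z)%Z).
have yw k y : (forall n : int, n < a + q%:Z -> y n = z n) ->
    (forall n : int, a <= n < a + (q * k)%:Z -> y (n + q%:Z) = y n) ->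
    forall n : int, a <= n < a + (q * k.+1)%:Z -> y n = w n.
  move=> y1 y3.
  have step (s : nat) (j : nat) : (s < q)%N -> (j <= k)%N ->
      y (a + s%:Z + (q * j)%:Z) = z (a + s%:Z).
    move=> sq; elim: j => [|j ih] jk; first by rewrite muln0 addr0 y1//; lia.
    rewrite -ih ?(ltnW jk)// -[RHS]y3; first by congr y; lia.
    by have : (q * j.+1 <= q * k)%N by [rewrite leq_mul2l jk orbT]; lia.
  move=> n /andP[an na].
  have [j [s [sq nE]]] : exists j s : nat, (s < q)%N /\ n = a + s%:Z + (q * j)%:Z.
    exists (`|(n - a)%R| %/ q)%N, (`|(n - a)%R| %% q)%N; split; first by rewrite ltn_mod.
    have := divn_eq `|(n - a)%R| q; lia.
  have jk : (j <= k)%N.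
    have : (q * j < q * k.+1)%N by lia.
    by rewrite ltn_mul2l q0 ltnS.
  rewrite nE step// /w; congr (z (_ + _)).
  rewrite (_ : _ - a = j%:Z * q%:Z + s%:Z); last by lia.
  by rewrite modzMDl modz_small//; lia.
have wper n : w (n + q%:Z) = w n.
  by rewrite /w addrAC -[q%:Z in X in (X %% _)%Z]mul1r addrC modzMDl.
have wpern n j : w (n + (q * j)%:Z) = w n.
  elim: j => [|j ih]; first by rewrite muln0 addr0.
  by rewrite mulnS addnC PoszD addrA wper.
have big k : exists y, [/\ Z y, forall n : int, n < a + q%:Z -> y n = z n,
    forall n : int, a + (q * k)%:Z <= n -> y n = z (n - (q * k)%:Z) &
    forall n : int, a <= n < a + (q * k.+1)%:Z -> y n = w n].
  have [y [Zy _ y1 y2 y3]] := insert_loop k Zz la.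
  by exists y; split => //; exact: yw.
exists w, a; split.
- apply: window_local => n; have [y [Zy _ _ yw']] := big L.
  exists y; split => //; exists (a + ((n - a) %% q%:Z)%Z) => i iL.
  have m0 : 0 <= ((n - a) %% q%:Z)%Z by rewrite modz_ge0//; lia.
  have m1 : ((n - a) %% q%:Z)%Z < q%:Z by rewrite ltz_pmod//; lia.
  have Lq : (L <= q * L)%N by rewrite leq_pmull.
  rewrite yw'; last by rewrite mulnS; apply/andP; split; lia.
  rewrite /w (_ : a + ((n - a) %% q%:Z)%Z + i%:Z - a = ((n - a) %% q%:Z)%Z + i%:Z); last by lia.
  by rewrite modzDml; congr (z (_ + (_ %% _)%Z)); lia.
- by move=> n; rewrite pr mulnC wpern.
- move=> k; have [y [Zy y1 y2 y3]] := big (r * k)%N; exists y; split => //.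
  + by move=> n na; apply: y1; lia.
  + by move=> n; rewrite pr -mulnA mulnCA; exact: y2.
  + move=> n; rewrite pr -mulnA mulnCA.
    by move=> /andP[an na]; apply: y3; rewrite mulnS; lia.
Qed.

Lemma finite_periodic : finite_set [set w : full_shift A | forall n : int, w (n + p%:Z) = w n].
Proof.
pose f (g : {ffun 'I_p -> A}) : full_shift A := fun n =>
  g (Ordinal (ltn_pmod `|(n %% p%:Z)%Z| period_gt0)).
apply: (@sub_finite_set _ _ (range f)); last first.
  by apply: finite_image; exact: (@finite_finset _ setT).
move=> w wp; exists [ffun i : 'I_p => w (i : nat)%:Z] => //.
have wpn n (j : nat) : w (n + (p * j)%:Z) = w n.
  elim: j => [|j ih]; first by rewrite muln0 addr0.
  by rewrite mulnS addnC PoszD addrA wp.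
apply/funext => n; rewrite /f ffunE /=.
have p0 := period_gt0.
have m0 : 0 <= (n %% p%:Z)%Z by rewrite modz_ge0//; lia.
have m1 : (n %% p%:Z)%Z < p%:Z by rewrite ltz_pmod//; lia.
rewrite modn_small; last by lia.
have := divz_eq n p%:Z; rewrite gez0_abs// => nE.
case: (divz n p%:Z) nE => j nE.
  by rewrite [in RHS]nE addrC -PoszM mulnC wpn.
rewrite -(wpn n j.+1); congr w; rewrite [in RHS]nE NegzE; lia.
Qed.

End finite_type.

(** * Equivariant images of shifts of finite type *)

Section finite_type_image.
Context (X : topologicalZmodType) (alpha : automorphism X).
Hypothesis X_hausdorff : hausdorff_space X.
Hypothesis X_homoclinic : forall x, homoclinic alpha x -> x = 0.
Context (B : finType) (F : seq (seq B)) (Phi : full_shift B -> X).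
Local Notation Z := (avoiding F).
Local Notation p := (period F).
Local Notation N := (word_count F).
Hypothesis Phi_continuous : {within Z, continuous Phi}.
Hypothesis Phi_equivariant : forall z, Z z -> Phi (shift_iter 1 z) = alpha (Phi z).
Local Notation it := (aut_iter alpha).

Lemma equivariant_iter z n : Z z -> Phi (shift_iter n z) = it n (Phi z).
Proof.
move=> Zz; have step k : Phi (shift_iter (k + 1) z) = alpha (Phi (shift_iter k z)).
  rewrite -Phi_equivariant; last exact: shift_closed.
  by congr Phi; apply/funext => m; rewrite /shift_iter; congr z; lia.
have h0 : Phi (shift_iter 0 z) = Phi z.
  by congr Phi; apply/funext => m; rewrite /shift_iter addr0.
elim/int_rec: n => [//|m ih|m ih].
  by rewrite (_ : m.+1%:Z = m%:Z + 1) ?step ?aut_iterS ?ih//; lia.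
apply: (@aut_inj _ alpha); rewrite -step -aut_iterS.
by rewrite (_ : - m.+1%:Z + 1 = - m%:Z)//; lia.
Qed.

(** Uniform continuity of [Phi] on the compact set [Z]. *)
Lemma continuity_window (U : set X) : nbhs 0 U -> exists m, forall z z',
  Z z -> Z z' -> cylinder z m z' -> U (Phi z' - Phi z).
Proof.
move=> U0.
have csub : continuous (fun w : X * X => w.1 - w.2) by exact: sub_continuous.
have : nbhs ((0 : X), (0 : X)) [set w : X * X | U (w.1 - w.2)].
  by apply: (csub (0, 0)); rewrite /= subrr.
case=> -[V1 V2] /= [V10 V20] V12.
have cZ : near_covering Z by apply/compact_near_coveringP; exact: finite_type_compact.
have := (near_covering_withinP _).2 cZ nat \oo
  (fun m z => forall z', Z z' -> cylinder z m z' -> U (Phi z' - Phi z)) _.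
case.
  move=> z Zz; have cz := (subspace_continuousP Z Phi).1 Phi_continuous z Zz.
  have cd : continuous (fun y : X => y - Phi z) by cts.
  have V0 : nbhs (Phi z) [set y | V1 (y - Phi z) /\ V2 (y - Phi z)].
    apply: filterI; [apply: (cd (Phi z) V1)|apply: (cd (Phi z) V2)].
      by rewrite /= subrr.
    by rewrite /= subrr.
  have [m0 hm0] := cylinder_nbhs (cz _ V0).
  exists (cylinder z m0, [set m | (m0 <= m)%N]) => /=.
    by split; [exact: nbhs_cylinder|exists m0].
  move=> [z1 m] /= [z1z m0m] Zz1 z' Zz' z'z1.
  have [h1 _] : [set y | V1 (y - Phi z) /\ V2 (y - Phi z)] (Phi z').
    apply: hm0 => // n nm; rewrite z'z1 ?z1z//; exact: leq_trans nm m0m.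
  have [_ h2] : [set y | V1 (y - Phi z) /\ V2 (y - Phi z)] (Phi z1) by exact: hm0.
  have := V12 (Phi z' - Phi z, Phi z1 - Phi z) (conj h1 h2).
  by rewrite /= opprB addrA subrK.
by move=> m _ /(_ m (leqnn m)) h; exists m => z z' Zz; exact: h.
Qed.

(** The difference of the images of two asymptotic points is homoclinic. *)
Lemma asymptotic_eq z z' (m0 : nat) : Z z -> Z z' ->
  (forall n : int, (m0 <= `|n|)%N -> z' n = z n) -> Phi z' = Phi z.
Proof.
move=> Zz Zz' zz'; apply/eqP; rewrite -subr_eq0; apply/eqP; apply: X_homoclinic.
move=> U U0; have [m hm] := continuity_window U0; exists (m0 + m)%N => n nm.
rewrite aut_iterB -!equivariant_iter//; apply: hm; [exact: shift_closed..|].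
by move=> k km; rewrite /shift_iter zz'//; lia.
Qed.

Lemma eq_of_close (a b : X) : (forall U, nbhs 0 U -> U (a - b)) -> a = b.
Proof.
move=> ab; apply/eqP; rewrite -subr_eq0; apply/negPn/negP => d0.
have h : nbhs (0 : X) (~` [set a - b]).
  apply: open_nbhs_nbhs; split; last by move=> /= /esym /eqP; apply/negP.
  apply: closed_openC; exact: accessible_closed_set1 (hausdorff_accessible X_hausdorff) _.
by have := ab _ h; apply.
Qed.

(** All insertions of the same length in [z] are asymptotic to each other, so they
    have the same image. Inserted far to the right, they converge to [z]; inserted
    far to the left, their translates by the length of the insertion do. *)
Lemma insert_invariant z y (a : int) k : Z z -> Z y ->
  (forall n : int, n <= a -> y n = z n) ->
  (forall n : int, a + (p * k)%:Z <= n -> y n = z (n - (p * k)%:Z)) ->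
  Phi y = Phi z /\ it (p * k)%:Z (Phi z) = Phi z.
Proof.
move=> Zz Zy y1 y2; set M := (p * k)%N in y2 *.
have Phiy : Phi y = Phi z.
  apply: eq_of_close => U /continuity_window[m hm].
  have [y' [a' [Zy' /andP[ma' _] y'1 y'2]]] := exists_insert m%:Z k Zz.
  have -> : Phi y = Phi y'.
    apply: (@asymptotic_eq _ _ (`|a| + `|a'| + M)%N) => // n nn.
    have [n0|n0] := ltP n 0; first by rewrite y1 ?y'1//; lia.
    by rewrite y2 ?y'2// /M; lia.
  by apply: hm => // n nm; apply: y'1; lia.
split => //; apply: eq_of_close => U /continuity_window[m hm].
have [y' [a' [Zy' /andP[_ ma'] y'1 y'2]]] := exists_insert (- m%:Z - N%:Z) k Zz.
rewrite -[X in it _ X]Phiy.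
have -> : Phi y = Phi y'.
  apply: (@asymptotic_eq _ _ (`|a| + `|a'| + M)%N) => // n nn.
  have [n0|n0] := ltP n 0; first by rewrite y1 ?y'1//; lia.
  by rewrite y2 ?y'2// /M; lia.
rewrite -equivariant_iter//; apply: hm => //; first exact: shift_closed.
move=> n nm; rewrite /shift_iter y'2; first by congr z; rewrite /M; lia.
by rewrite /M; lia.
Qed.

(** Seen from the middle of a long insertion, the point looks like the periodic
    point [w], while insertions and translations by multiples of the period do not
    change the image. So the periodic points have all the values of [Phi]. *)
Lemma finite_type_image_finite : finite_set (Phi @` Z).
Proof.
apply: (@sub_finite_set _ _ (Phi @` [set w : full_shift B | forall n : int, w (n + p%:Z) = w n])); last first.
  by apply: finite_image; exact: finite_periodic.
move=> _ [z Zz <-]; have [w [a [Zw wp wy]]] := exists_periodic Zz.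
exists w => //; apply/esym; apply: eq_of_close => U /continuity_window[m hm].
(* the middle of an insertion of length [2 * K] periods is [K] periods away from both of its ends *)
pose K := (`|a| + m).+1; have [y [Zy y1 y2 yw]] := wy (2 * K)%N.
have [Phiy itz] := insert_invariant Zz Zy y1 y2.
have [y' [Zy' y'1 y'2 _]] := wy K.
have [_ itK] := insert_invariant Zz Zy' y'1 y'2.
rewrite -itK -Phiy -equivariant_iter//; apply: hm => //; first exact: shift_closed.
have wpn n (j : nat) : w (n + (p * j)%:Z) = w n.
  elim: j => [|j ih]; first by rewrite muln0 addr0.
  by rewrite mulnS addnC PoszD addrA wp.
have pK : (K <= p * K)%N by rewrite leq_pmull// period_gt0.
move=> n nm; rewrite /shift_iter yw ?wpn//.
have -> : (p * (2 * K) = 2 * (p * K))%N by rewrite mulnCA.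
by apply/andP; split; rewrite /K in pK *; lia.
Qed.

End finite_type_image.

(** A nonzero [x] makes the group nontrivial, which gives a character; its iterates
    satisfy a relation because independent ones contradict irreducibility. *)
Theorem homoclinic_trivial (X : topologicalZmodType) (R : realType)
    (I : (X -> R) -> R) (alpha : automorphism X) :
  hausdorff_space X -> compact [set: X] -> connected [set: X] ->
  invariant_mean I -> irreducible alpha -> ~ expansive alpha ->
  forall x, homoclinic alpha x -> x = 0.
Proof.
move=> hX cX conX IP irr nexp x hx.
have [//|x0] := eqVneq x 0.
have [c [s [[cc cs [y cy] cs1] csD]]] := exists_character cX hX IP x0.
have [theta thetaP thetac] := exists_angle cc cs cs1 csD.
have theta_nontrivial : exists z, theta z \isn't a Num.int.
  by exists y; apply: contra cy => /cos_turn_int[<- _]; rewrite thetac.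
apply: (no_homoclinic cX hX conX thetaP theta_nontrivial irr nexp _ hx).
apply: contrapT => h.
apply: (independent_not_irreducible cX hX IP thetaP _ irr) => g g0 rg.
by apply: h; exists g.
Qed.

Theorem corollary4p11
  (X : topologicalZmodType)
  (X_hausdorff : hausdorff_space X)
  (X_compact : compact [set: X])
  (X_connected : connected [set: X])
  (R : realType) (haar : probability (borel X) R) (haarP : is_haar haar)
  (alpha : automorphism X)
  (alpha_irreducible : irreducible alpha)
  (alpha_ergodic : ergodic haar alpha)
  (alpha_nonexpansive : ~ expansive alpha)
  (A : finType) (Y : set (full_shift A))
  (Y_sofic : sofic_shift Y)
  (Y_transitive : topologically_transitive Y)
  (phi : full_shift A -> X)
  (phi_continuous : {within Y, continuous phi})
  (phi_equivariant : forall y, Y y -> phi (shift_iter 1 y) = alpha (phi y)) :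
  finite_set (phi @` Y).
Proof.
have trivial := homoclinic_trivial X_hausdorff X_compact X_connected
  (haar_invariant_mean X_compact haarP) alpha_irreducible alpha_nonexpansive.
have [_ [B [Z [psi [[F ZE] cpsi psi_equivariant psiZ]]]]] := Y_sofic.
have Ypsi z : Z z -> Y (psi z) by move=> Zz; rewrite -psiZ; exists z.
have -> : phi @` Y = (phi \o psi) @` avoiding F by rewrite /avoiding -ZE -psiZ image_comp.
apply: (finite_type_image_finite X_hausdorff trivial).
  rewrite /avoiding -ZE; apply/subspace_continuousP => z Zz W hW.
  have h := (subspace_continuousP Y phi).1 phi_continuous (psi z) (Ypsi z Zz) _ hW.
  have h2 : nbhs z [set t | Z t -> Y (psi t) -> W (phi (psi t))].
    exact: ((subspace_continuousP Z psi).1 cpsi z Zz _ h).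
  have h3 : nbhs z [set t | Z t -> W (phi (psi t))].
    by apply: (@filterS _ (nbhs z) _ _ _ _ h2) => t Yt Zt; exact: Yt Zt (Ypsi t Zt).
  exact: h3.
move=> z; rewrite /avoiding -ZE => Zz /=.
by rewrite psi_equivariant// phi_equivariant//; exact: Ypsi.
Qed.
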